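(* Let $k$ be a saturated algebraically closed field of characteristic zero. Then there is a uniformly definable function $\#:D(k)\rightarrow k$ such that $(k, D(k), D(k^{2}), \ldots, \#)$ is a model of ${\tt \Delta^{1}_{1}\text{-}HP}_{0}+ \neg {\tt \Sigma^{1}_{1}\text{-}PH}_{0}+\neg {\tt \Pi^{1}_{1}\text{-}HP}_{0}$. Further, there is no function $\partial:D(k)\rightarrow k$ such that $(k, D(k), D(k^{2}), \ldots, \partial)$ is a model of ${\tt \Delta^{1}_{1}\text{-}BL}_{0}$.
   Context: $D(k^n)$ is the set of subsets of $k^n$ definable (with parameters) in the field $k$; $(k,D(k),D(k^2),\ldots,\#)$ is the many-sorted structure with objects $k$, $n$-ary relations $D(k^n)$ (elements of $D(k)$ are sets) and $\#:D(k)\to k$. $\#$ is uniformly definable if for every formula $\theta(x,\bar y)$ with nonempty tuple $\bar y$ of parameter variables there is a formula $\theta'(x,\bar y)$ with $\#(\theta(\cdot,\bar a))=b\iff k\models\theta'(b,\bar a)$ for all $\bar a,b$. Theories: Hume's Principle is $\#X=\#Y\leftrightarrow$ there is a bijection $f:X\to Y$ (graph a binary relation of the structure); Basic Law V is $\partial X=\partial Y\leftrightarrow X=Y$. Formula hierarchy: arithmetical formulas have no bound relation variables; $\Sigma^1_n/\Pi^1_n$ built by blocks of existential/universal relation quantifiers of any arity. ${\tt AHP}_0$: Hume's Principle plus comprehension $\exists R\forall\bar n[\bar n\in R\leftrightarrow\varphi(\bar n)]$ for arithmetical $\varphi$ with parameters. ${\tt \Delta^1_1\text{-}HP}_0$ (resp.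 ${\tt \Delta^1_1\text{-}BL}_0$): Hume's Principle (resp. Basic Law V) plus $[\forall\bar n(\varphi\leftrightarrow\psi)]\to\exists R\forall\bar n[\bar n\in R\leftrightarrow\varphi(\bar n)]$ for $\Sigma^1_1$ $\varphi$, $\Pi^1_1$ $\psi$. ${\tt \Sigma^1_1\text{-}PH}_0$: ${\tt AHP}_0$ plus $[\forall \bar n\,\exists P\,\varphi(\bar n,P)]\rightarrow[\exists R\,\forall \bar n\,\forall P\,(\forall \bar m\,(\bar m\in P\leftrightarrow \bar n\bar m\in R))\rightarrow \varphi(\bar n,P)]$ for $\Sigma^1_1$ $\varphi$. ${\tt \Pi^1_1\text{-}HP}_0$: Hume's Principle plus comprehension for $\Pi^1_1$ formulas. *)

(* Defs.v *)
From mathcomp Require Import all_boot all_algebra.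
From mathcomp Require Import boolp classical_sets functions cardinality.
Set Implicit Arguments.
Unset Strict Implicit.
Unset Printing Implicit Defensive.
Import GRing.Theory.
Local Open Scope classical_set_scope.

(** * Second-order structures with a type-lowering operator

    Index [n] stands for arity [n.+1], so that every relation has positive
    arity; in particular [srel M 0] consists of subsets of the domain. The
    signature has no non-logical symbol besides the operator [absop], which
    plays the role of # (Hume's Principle) or of ∂ (Basic Law V). *)

Record structure := Structure {
  dom : Type;
  srel : forall n : nat, set (set (n.+1.-tuple dom));
  absop : @srel 0 -> dom }.

Arguments srel : clear implicits.

Inductive oterm :=
| OVar of nat
| OAbs of nat. (* the operator applied to the [i]-th unary relation variable *)

(** Variables are named by numbers; each arity has its own relation variables. *)
Inductive form :=
| FEq of oterm & oterm
| FEqR (n : nat) of nat & nat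
| FIn (n : nat) of n.+1.-tuple oterm & nat
| FNot of form
| FAnd of form & form
| FOr of form & form
| FImp of form & form
| FEx of nat & form
| FAll of nat & form
| FExR (n : nat) of nat & form
| FAllR (n : nat) of nat & form.

Section Satisfaction.
Variable M : structure.

Definition renv := forall n : nat, nat -> srel M n.

Definition upd_obj (e : nat -> dom M) (i : nat) (x : dom M) : nat -> dom M :=
  fun j => if j == i then x else e j.

Definition upd_rel (E : renv) (n i : nat) (X : srel M n) : renv :=
  dfwith E (fun j => if j == i then X else E n j).

(** [v] is assigned to the variables [0 .. size v - 1]. *)
Definition upd_seq (e : nat -> dom M) (v : seq (dom M)) : nat -> dom M :=
  fun i => nth (e i) v i.

Definition oval (e : nat -> dom M) (E : renv) (t : oterm) : dom M :=
  match t with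
  | OVar i => e i
  | OAbs i => absop (E 0%N i)
  end.

Fixpoint sat (e : nat -> dom M) (E : renv) (f : form) : Prop :=
  match f with
  | FEq s t => oval e E s = oval e E t
  | FEqR n i j => E n i = E n j
  | FIn n ts i => val (E n i) (map_tuple (oval e E) ts)
  | FNot f => ~ sat e E f
  | FAnd f g => sat e E f /\ sat e E g
  | FOr f g => sat e E f \/ sat e E g
  | FImp f g => sat e E f -> sat e E g
  | FEx i f => exists x, sat (upd_obj e i x) E f
  | FAll i f => forall x, sat (upd_obj e i x) E f
  | FExR n i f => exists X : srel M n, sat e (upd_rel E i X) f
  | FAllR n i f => forall X : srel M n, sat e (upd_rel E i X) f
  end.

End Satisfaction.

Fixpoint arithmetical (f : form) : bool :=
  match f with
  | FEq _ _ | FEqR _ _ _ | FIn _ _ _ => true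
  | FNot f | FEx _ f | FAll _ f => arithmetical f
  | FAnd f g | FOr f g | FImp f g => arithmetical f && arithmetical g
  | FExR _ _ _ | FAllR _ _ _ => false
  end.

Fixpoint Sigma11 (f : form) : bool :=
  if f is FExR _ _ g then Sigma11 g else arithmetical f.

Fixpoint Pi11 (f : form) : bool :=
  if f is FAllR _ _ g then Pi11 g else arithmetical f.

Section Theories.
Variable M : structure.

Definition bijection_graph (X Y : srel M 0) (F : srel M 1) : Prop :=
  [/\ forall x y, val F [tuple x; y] -> val X [tuple x] /\ val Y [tuple y],
      forall x, val X [tuple x] -> exists! y, val F [tuple x; y]
    & forall y, val Y [tuple y] -> exists! x, val F [tuple x; y]].

Definition HumePrinciple : Prop :=
  forall X Y : srel M 0,
    absop X = absop Y <-> exists F : srel M 1, bijection_graph X Y F.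

Definition BasicLawV : Prop :=
  forall X Y : srel M 0, absop X = absop Y <-> X = Y.

(** In the schemata below, up to renaming of variables, the displayed tuple of
    an instance with [n.+1] entries consists of the object variables [0 .. n];
    all the other free variables are parameters, with values given by the
    environments. The relation whose existence is asserted is not free in the
    formula, as the formula is evaluated before that relation is chosen. *)
Definition comprehension (C : form -> bool) : Prop :=
  forall (n : nat) (f : form) (e : nat -> dom M) (E : renv M), C f ->
    exists R : srel M n, forall v : n.+1.-tuple (dom M),
      val R v <-> sat (upd_seq e v) E f.

Definition Delta11_comprehension : Prop :=
  forall (n : nat) (f g : form) (e : nat -> dom M) (E : renv M),
    Sigma11 f -> Pi11 g ->
    (forall v : n.+1.-tuple (dom M),
       sat (upd_seq e v) E f <-> sat (upd_seq e v) E g) ->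
    exists R : srel M n, forall v : n.+1.-tuple (dom M),
      val R v <-> sat (upd_seq e v) E f.

(** The relation variable chosen by [Sigma11_choice] is the variable [0] of
    arity [m.+1]; [R] has arity [n.+1 + m.+1], written as [(n + m.+1).+1]. *)
Definition Sigma11_choice : Prop :=
  forall (n m : nat) (f : form) (e : nat -> dom M) (E : renv M), Sigma11 f ->
    (forall v : n.+1.-tuple (dom M), exists P : srel M m,
       sat (upd_seq e v) (upd_rel E 0 P) f) ->
    exists R : srel M (n + m.+1), forall (v : n.+1.-tuple (dom M)) (P : srel M m),
      (forall w : m.+1.-tuple (dom M), val P w <-> val R (cat_tuple v w)) ->
      sat (upd_seq e v) (upd_rel E 0 P) f.

Definition AHP0 : Prop := HumePrinciple /\ comprehension arithmetical.
Definition Delta11_HP0 : Prop := HumePrinciple /\ Delta11_comprehension.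
Definition Delta11_BL0 : Prop := BasicLawV /\ Delta11_comprehension.
Definition Sigma11_PH0 : Prop := AHP0 /\ Sigma11_choice.
Definition Pi11_HP0 : Prop := HumePrinciple /\ comprehension Pi11.

End Theories.

(** * Definability in a field

    First-order formulas are those of [GRing.formula k]: their atoms may use
    constants from [k] (the parameters) as well as inverses and the unit
    predicate, which are definable from the field operations. [GRing.holds]
    gives the value 0 to the variables beyond the end of the valuation. *)

Fixpoint term_over (k : Type) (A : set k) (t : GRing.term k) : Prop :=
  match t with
  | GRing.Var _ | GRing.NatConst _ => True
  | GRing.Const c => A c
  | GRing.Add s t | GRing.Mul s t => term_over A s /\ term_over A t
  | GRing.Opp t | GRing.NatMul t _ | GRing.Inv t | GRing.Exp t _ =>
      term_over A t
  end.

Fixpoint formula_over (k : Type) (A : set k) (f : GRing.formula k) : Prop :=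
  match f with
  | GRing.Bool _ => True
  | GRing.Equal s t => term_over A s /\ term_over A t
  | GRing.Unit t => term_over A t
  | GRing.And f g | GRing.Or f g | GRing.Implies f g =>
      formula_over A f /\ formula_over A g
  | GRing.Not f | GRing.Exists _ f | GRing.Forall _ f => formula_over A f
  end.

(** [~~ ([set: k] #<= A)] says that [A] has smaller cardinality than [k]; the
    element sought is the value of the variable 0. *)
Definition saturated (k : fieldType) : Prop :=
  forall A : set k, ~~ ([set: k] #<= A)%card ->
  forall p : set (GRing.formula k), p `<=` formula_over A ->
    (forall q : set (GRing.formula k), finite_set q -> q `<=` p ->
       exists x : k, forall f, q f -> GRing.holds [:: x] f) ->
    exists x : k, forall f, p f -> GRing.holds [:: x] f.

Definition definable (k : fieldType) (n : nat) : set (set (n.-tuple k)) :=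
  [set X | exists f : GRing.formula k,
     forall v : n.-tuple k, X v <-> GRing.holds v f].

Arguments definable : clear implicits.

Definition definable_structure (k : fieldType) (num : definable k 1 -> k) :
    structure :=
  @Structure k (fun n => definable k n.+1) num.

(** [theta] and [theta'] have no parameters besides the displayed tuple [a];
    the variable [x] is the variable 0, and [a] is the value of the variables
    [1 .. m.+1]. *)
Definition uniformly_definable (k : fieldType) (num : definable k 1 -> k) : Prop :=
  forall (m : nat) (theta : GRing.formula k), formula_over set0 theta ->
  exists2 theta' : GRing.formula k, formula_over set0 theta' &
    forall (a : m.+1.-tuple k) (b : k) (X : definable k 1),
      (forall x : k, val X [tuple x] <-> GRing.holds (x :: a) theta) ->
      (num X = b <-> GRing.holds (b :: a) theta').

(* Main.v *)
Require Import Defs.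
From mathcomp Require Import all_boot all_algebra.
From mathcomp Require Import boolp classical_sets functions cardinality.
From mathcomp Require Import closed_field ring.
Set Implicit Arguments.
Unset Strict Implicit.
Unset Printing Implicit Defensive.
Import GRing.Theory.
Local Open Scope classical_set_scope.
Local Open Scope ring_scope.

(** A definable subset of [k] is finite or cofinite; number it by its number of
    elements [n], resp. by [- (n + 1)] where [n] is the number of elements of
    its complement. Hume's Principle then says that no definable bijection
    changes the size of the complement of a cofinite set: by quantifier
    elimination and characteristic zero, a definable injection is generically a
    rational function, hence, being injective, a Moebius transformation, which
    permutes the projective line.

    The numbers are uniformly definable, so an arithmetical formula of the
    structure is first-order over [k], and a [Sigma11] formula is a union of
    sets first-order definable over one finite set of parameters. When the
    complement is such a union too, saturation extracts finite subunions, and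
    the set is definable. A choice function for [P = {y}, y ^ 2 = x] would be a
    definable square root, and the set of the [x] that are not numbers is
    [Pi11] but neither finite nor cofinite. For Basic Law V, the graph of
    [x |-> del {x}] is [Delta11], so this injection is definable, hence onto, and
    takes the value [del set0]. *)

(** * Definable predicates on environments *)

(** Two uniformities shape the proof. The size of the finite side of a definable subset of the line
    is bounded by the formula alone, whatever the parameters; its elements are therefore listed in
    finitely many possible lengths, and the number is a first-order function of the parameters.
    Moreover, definability is always relative to an explicit list of constants: the empty list gives
    uniform definability, and a common finite list for all pieces of a [Sigma11] formula is what
    saturation is applied to. Generic points are replaced by cofiniteness. Generic rationality comes
    from a polynomial of least degree in [y] that vanishes infinitely often on the graph: its zeros
    over a generic [x] all satisfy the formula of the graph, so there is only one, and separability
    forces degree one. A permutation of [k] agreeing almost everywhere with the given bijection then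
    reduces Hume's Principle for cofinite sets to counting. *)

Section Formulas.
Variable k : fieldType.
Implicit Types (e : nat -> k) (t : GRing.term k) (f : GRing.formula k).
Implicit Types (c s : seq k) (x : k).

Definition upd (T : Type) (e : nat -> T) i (x : T) := fun j => if j == i then x else e j.

Definition scons x e : nat -> k := fun j => if j is j'.+1 then e j' else x.

Definition shift n e : nat -> k := fun j => e (n + j)%N.

Fixpoint scat c e : nat -> k := if c is x :: c' then scons x (scat c' e) else e.

Lemma scat_lt c e j : (j < size c)%N -> scat c e j = nth 0 c j.
Proof. by elim: c j => [|x c IHc] [|j] //=; apply: IHc. Qed.

Lemma shift_scat c e n : size c = n -> shift n (scat c e) = e.
Proof.
by move=> <-; apply/funext => j; rewrite /shift; elim: c => //= x c IHc; rewrite addSn.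
Qed.

Lemma nth_scat c : nth 0 c = scat c (fun=> 0).
Proof. by apply/funext => j; elim: c j => [|x c IHc] [|j] //=. Qed.

Fixpoint feval e t : k :=
  match t with
  | GRing.Var i => e i
  | GRing.Const c => c
  | GRing.NatConst n => n%:R
  | GRing.Add t1 t2 => feval e t1 + feval e t2
  | GRing.Opp t1 => - feval e t1
  | GRing.NatMul t1 n => feval e t1 *+ n
  | GRing.Mul t1 t2 => feval e t1 * feval e t2
  | GRing.Inv t1 => (feval e t1)^-1
  | GRing.Exp t1 n => feval e t1 ^+ n
  end.

(** Environments that are total functions spare the bookkeeping of lengths
    needed with the finite ones of [GRing.holds]. *)
Fixpoint fholds e f : Prop :=
  match f with
  | GRing.Bool b => b
  | GRing.Equal t1 t2 => feval e t1 = feval e t2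
  | GRing.Unit t1 => feval e t1 \in GRing.unit
  | GRing.And f1 f2 => fholds e f1 /\ fholds e f2
  | GRing.Or f1 f2 => fholds e f1 \/ fholds e f2
  | GRing.Implies f1 f2 => fholds e f1 -> fholds e f2
  | GRing.Not f1 => ~ fholds e f1
  | GRing.Exists i f1 => exists x, fholds (upd e i x) f1
  | GRing.Forall i f1 => forall x, fholds (upd e i x) f1
  end.

Lemma feval_nth c t : feval (nth 0 c) t = GRing.eval c t.
Proof. by elim: t => //= [t1 -> t2 -> | t1 -> | t1 -> | t1 -> t2 -> | t1 -> | t1 ->]. Qed.

Lemma fholds_nth c f : fholds (nth 0 c) f = GRing.holds c f.
Proof.
elim: f c => //= [t1 t2|t|f1 IH1 f2 IH2|f1 IH1 f2 IH2|f1 IH1 f2 IH2|f IHf|i f IHf|i f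
  IHf] c;
  rewrite ?feval_nth ?IH1 ?IH2 ?IHf //.
- apply: eq_exists => x; rewrite -IHf; congr fholds.
  by apply/funext => j; rewrite nth_set_nth.
- apply: eq_forall => x; rewrite -IHf; congr fholds.
  by apply/funext => j; rewrite nth_set_nth.
Qed.

Fixpoint tbound t : nat :=
  match t with
  | GRing.Var i => i.+1
  | GRing.Const _ | GRing.NatConst _ => 0
  | GRing.Add t1 t2 | GRing.Mul t1 t2 => maxn (tbound t1) (tbound t2)
  | GRing.Opp t1 | GRing.NatMul t1 _ | GRing.Inv t1 | GRing.Exp t1 _ => tbound t1
  end.

Fixpoint fbound f : nat :=
  match f with
  | GRing.Bool _ => 0
  | GRing.Equal t1 t2 => maxn (tbound t1) (tbound t2)
  | GRing.Unit t1 => tbound t1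
  | GRing.And f1 f2 | GRing.Or f1 f2 | GRing.Implies f1 f2 =>
      maxn (fbound f1) (fbound f2)
  | GRing.Not f1 => fbound f1
  | GRing.Exists i f1 | GRing.Forall i f1 => maxn i.+1 (fbound f1)
  end.

Lemma eq_feval e e' t :
  (forall j, (j < tbound t)%N -> e j = e' j) -> feval e t = feval e' t.
Proof.
elim: t => //= [j|t1 IH1 t2 IH2|t1 IH1|t1 IH1 n|t1 IH1 t2 IH2|t1 IH1|t1 IH1 n] H.
- exact: H.
- by rewrite IH1 ?IH2 // => j Hj; apply: H; rewrite leq_max Hj ?orbT.
- by rewrite IH1.
- by rewrite IH1.
- by rewrite IH1 ?IH2 // => j Hj; apply: H; rewrite leq_max Hj ?orbT.
- by rewrite IH1.
- by rewrite IH1.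
Qed.

Lemma eq_fholds e e' f :
  (forall j, (j < fbound f)%N -> e j = e' j) -> fholds e f = fholds e' f.
Proof.
elim: f e e' => //= [t1 t2|t|f1 IH1 f2 IH2|f1 IH1 f2 IH2|f1 IH1 f2 IH2|f IHf|i f IHf|i f
  IHf]
  e e' H.
- by rewrite (@eq_feval e e' t1) ?(@eq_feval e e' t2) // => j Hj;
    apply: H; rewrite leq_max Hj ?orbT.
- by rewrite (eq_feval H).
- by rewrite (IH1 e e') ?(IH2 e e') // => j Hj; apply: H; rewrite leq_max Hj ?orbT.
- by rewrite (IH1 e e') ?(IH2 e e') // => j Hj; apply: H; rewrite leq_max Hj ?orbT.
- by rewrite (IH1 e e') ?(IH2 e e') // => j Hj; apply: H; rewrite leq_max Hj ?orbT.
- by rewrite (IHf e e').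
- apply: eq_exists => x; apply: IHf => j Hj; rewrite /upd; case: eqP => // _.
  by apply: H; rewrite leq_max Hj orbT.
- apply: eq_forall => x; apply: IHf => j Hj; rewrite /upd; case: eqP => // _.
  by apply: H; rewrite leq_max Hj orbT.
Qed.

(** * Substitution of terms for variables *)

Fixpoint tsubs (g : nat -> GRing.term k) t : GRing.term k :=
  match t with
  | GRing.Var i => g i
  | GRing.Const c => GRing.Const c
  | GRing.NatConst n => GRing.NatConst k n
  | GRing.Add t1 t2 => GRing.Add (tsubs g t1) (tsubs g t2)
  | GRing.Opp t1 => GRing.Opp (tsubs g t1)
  | GRing.NatMul t1 n => GRing.NatMul (tsubs g t1) n
  | GRing.Mul t1 t2 => GRing.Mul (tsubs g t1) (tsubs g t2)
  | GRing.Inv t1 => GRing.Inv (tsubs g t1)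
  | GRing.Exp t1 n => GRing.Exp (tsubs g t1) n
  end.

(** Capture is avoided because [b] exceeds every variable of the terms
    substituted so far. *)
Fixpoint fsubs b (g : nat -> GRing.term k) f : GRing.formula k :=
  match f with
  | GRing.Bool c => GRing.Bool c
  | GRing.Equal t1 t2 => GRing.Equal (tsubs g t1) (tsubs g t2)
  | GRing.Unit t1 => GRing.Unit (tsubs g t1)
  | GRing.And f1 f2 => GRing.And (fsubs b g f1) (fsubs b g f2)
  | GRing.Or f1 f2 => GRing.Or (fsubs b g f1) (fsubs b g f2)
  | GRing.Implies f1 f2 => GRing.Implies (fsubs b g f1) (fsubs b g f2)
  | GRing.Not f1 => GRing.Not (fsubs b g f1)
  | GRing.Exists i f1 => GRing.Exists b (fsubs b.+1 (upd g i (GRing.Var k b)) f1)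
  | GRing.Forall i f1 => GRing.Forall b (fsubs b.+1 (upd g i (GRing.Var k b)) f1)
  end.

Lemma feval_tsubs e g t : feval e (tsubs g t) = feval (fun j => feval e (g j)) t.
Proof. by elim: t => //= [t1 -> t2 -> | t1 -> | t1 -> | t1 -> t2 -> | t1 -> | t1 ->]. Qed.

Lemma fholds_fsubs b e g f :
  (forall j, (j < fbound f)%N -> (tbound (g j) <= b)%N) ->
  fholds e (fsubs b g f) = fholds (fun j => feval e (g j)) f.
Proof.
have aux f1 i : (forall b e g,
      (forall j, (j < fbound f1)%N -> (tbound (g j) <= b)%N) ->
      fholds e (fsubs b g f1) = fholds (fun j => feval e (g j)) f1) ->
    forall b e g x, (forall j, (j < maxn i.+1 (fbound f1))%N -> (tbound (g j) <= b)%N) ->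
    fholds (upd e b x) (fsubs b.+1 (upd g i (GRing.Var k b)) f1) =
    fholds (upd (fun j => feval e (g j)) i x) f1.
  move=> IH b1 e1 g1 x H; rewrite IH; last first.
    move=> j Hj; rewrite /upd; case: eqP => //= _; apply: leqW; apply: H.
    by rewrite leq_max Hj orbT.
  apply: eq_fholds => j Hj; rewrite /upd; case: eqP => //= _; first by rewrite eqxx.
  apply: eq_feval => l Hl; case: eqP => // El.
  by have := H j; rewrite leq_max Hj orbT => /(_ isT); rewrite leqNgt -El Hl.
elim: f b e g => //= [t1 t2|t|f1 IH1 f2 IH2|f1 IH1 f2 IH2|f1 IH1 f2 IH2|f IHf|i f IHf|i f
  IHf]
  b e g H.
- by rewrite !feval_tsubs.
- by rewrite feval_tsubs.
- by rewrite IH1 ?IH2 // => j Hj; apply: H; rewrite leq_max Hj ?orbT.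
- by rewrite IH1 ?IH2 // => j Hj; apply: H; rewrite leq_max Hj ?orbT.
- by rewrite IH1 ?IH2 // => j Hj; apply: H; rewrite leq_max Hj ?orbT.
- by rewrite IHf.
- by apply: eq_exists => x; apply: aux.
- by apply: eq_forall => x; apply: aux.
Qed.

Lemma term_over_tsubs (A : set k) g t :
  (forall j, term_over A (g j)) -> term_over A t -> term_over A (tsubs g t).
Proof. by move=> Ag; elim: t => //= t1 IH1 t2 IH2 [/IH1 ? /IH2 ?]. Qed.

Lemma formula_over_fsubs (A : set k) b g f :
  (forall j, term_over A (g j)) -> formula_over A f -> formula_over A (fsubs b g f).
Proof.
elim: f b g => //= [t1 t2|t|f1 IH1 f2 IH2|f1 IH1 f2 IH2|f1 IH1 f2 IH2|i f IHf|i f IHf]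
  b g Ag.
- by case=> ? ?; split; apply: term_over_tsubs.
- exact: term_over_tsubs.
- by case=> ? ?; split; [apply: IH1|apply: IH2].
- by case=> ? ?; split; [apply: IH1|apply: IH2].
- by case=> ? ?; split; [apply: IH1|apply: IH2].
- by apply: IHf => j; rewrite /upd; case: eqP.
- by apply: IHf => j; rewrite /upd; case: eqP.
Qed.

Lemma term_over_sub (A B : set k) t : A `<=` B -> term_over A t -> term_over B t.
Proof. by move=> AB; elim: t => //= t1 IH1 t2 IH2 [/IH1 ? /IH2 ?]. Qed.

Lemma formula_over_sub (A B : set k) f :
  A `<=` B -> formula_over A f -> formula_over B f.
Proof.
move=> AB; elim: f => //=
  [t1 t2 [? ?]|t ?|f1 IH1 f2 IH2 [? ?]|f1 IH1 f2 IH2 [? ?]|f1 IH1 f2 IH2 [? ?]].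
- by split; apply: term_over_sub; eassumption.
- by apply: term_over_sub; eassumption.
- by split; [apply: IH1|apply: IH2].
- by split; [apply: IH1|apply: IH2].
- by split; [apply: IH1|apply: IH2].
Qed.

(** * Constants of a formula and their replacement by variables *)

Fixpoint tconsts t : seq k :=
  match t with
  | GRing.Const c => [:: c]
  | GRing.Var _ | GRing.NatConst _ => [::]
  | GRing.Add t1 t2 | GRing.Mul t1 t2 => tconsts t1 ++ tconsts t2
  | GRing.Opp t1 | GRing.NatMul t1 _ | GRing.Inv t1 | GRing.Exp t1 _ => tconsts t1
  end.

Fixpoint fconsts f : seq k :=
  match f with
  | GRing.Bool _ => [::]
  | GRing.Equal t1 t2 => tconsts t1 ++ tconsts t2
  | GRing.Unit t1 => tconsts t1
  | GRing.And f1 f2 | GRing.Or f1 f2 | GRing.Implies f1 f2 => fconsts f1 ++ fconsts f2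
  | GRing.Not f1 | GRing.Exists _ f1 | GRing.Forall _ f1 => fconsts f1
  end.

Lemma term_over_tconsts t : term_over [set` tconsts t] t.
Proof.
elim: t => //= [c|t1 IH1 t2 IH2|t1 IH1 t2 IH2]; first by rewrite inE.
- by split; [move: IH1|move: IH2]; apply: term_over_sub => x /=; rewrite mem_cat => ->;
    rewrite ?orbT.
- by split; [move: IH1|move: IH2]; apply: term_over_sub => x /=; rewrite mem_cat => ->;
    rewrite ?orbT.
Qed.

Lemma formula_over_fconsts f : formula_over [set` fconsts f] f.
Proof.
elim: f => //= [t1 t2|t|f1 IH1 f2 IH2|f1 IH1 f2 IH2|f1 IH1 f2 IH2];
  last 3 first.
- by split; [move: IH1|move: IH2]; apply: formula_over_sub => x /=;
    rewrite mem_cat => ->; rewrite ?orbT.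
- by split; [move: IH1|move: IH2]; apply: formula_over_sub => x /=;
    rewrite mem_cat => ->; rewrite ?orbT.
- by split; [move: IH1|move: IH2]; apply: formula_over_sub => x /=;
    rewrite mem_cat => ->; rewrite ?orbT.
- have [IH1 IH2] := (term_over_tconsts t1, term_over_tconsts t2).
  by split; [move: IH1|move: IH2]; apply: term_over_sub => x /=; rewrite mem_cat => ->;
    rewrite ?orbT.
- exact: term_over_tconsts.
Qed.

Fixpoint tgen c t : GRing.term k :=
  match t with
  | GRing.Var i => GRing.Var k (size c + i)
  | GRing.Const x => GRing.Var k (index x c)
  | GRing.NatConst n => GRing.NatConst k n
  | GRing.Add t1 t2 => GRing.Add (tgen c t1) (tgen c t2)
  | GRing.Opp t1 => GRing.Opp (tgen c t1)
  | GRing.NatMul t1 n => GRing.NatMul (tgen c t1) n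
  | GRing.Mul t1 t2 => GRing.Mul (tgen c t1) (tgen c t2)
  | GRing.Inv t1 => GRing.Inv (tgen c t1)
  | GRing.Exp t1 n => GRing.Exp (tgen c t1) n
  end.

(** The constants [c] become the variables [0 .. size c - 1]. *)
Fixpoint fgen c f : GRing.formula k :=
  match f with
  | GRing.Bool b => GRing.Bool b
  | GRing.Equal t1 t2 => GRing.Equal (tgen c t1) (tgen c t2)
  | GRing.Unit t1 => GRing.Unit (tgen c t1)
  | GRing.And f1 f2 => GRing.And (fgen c f1) (fgen c f2)
  | GRing.Or f1 f2 => GRing.Or (fgen c f1) (fgen c f2)
  | GRing.Implies f1 f2 => GRing.Implies (fgen c f1) (fgen c f2)
  | GRing.Not f1 => GRing.Not (fgen c f1)
  | GRing.Exists i f1 => GRing.Exists (size c + i) (fgen c f1)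
  | GRing.Forall i f1 => GRing.Forall (size c + i) (fgen c f1)
  end.

Lemma formula_over_fgen c f : formula_over set0 (fgen c f).
Proof.
have tP t : term_over set0 (tgen c t) by elim: t.
by elim: f => //=.
Qed.

Lemma feval_tgen c e t : term_over [set` c] t ->
  feval (scat c e) (tgen c t) = feval e t.
Proof.
elim: t => //= [i _|x cx|t1 IH1 t2 IH2 []|t1 IH1 /IH1|t1 IH1 n /IH1|t1 IH1 t2 IH2 []|t1
  IH1 /IH1|t1 IH1 n /IH1].
- by rewrite -/(shift (size c) _ i) shift_scat.
- by rewrite scat_lt ?index_mem // nth_index.
- by move=> /IH1 -> /IH2 ->.
- by move=> ->.
- by move=> ->.
- by move=> /IH1 -> /IH2 ->.
- by move=> ->.
- by move=> ->.
Qed.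

Lemma fholds_fgen c e f : formula_over [set` c] f ->
  fholds (scat c e) (fgen c f) = fholds e f.
Proof.
have updE i x e1 : upd (scat c e1) (size c + i) x = scat c (upd e1 i x).
  apply/funext => j; have [jc|cj] := ltnP j (size c).
    rewrite scat_lt // /upd ltn_eqF ?scat_lt //.
    by rewrite (leq_trans jc) // leq_addr.
  rewrite -(subnKC cj) /upd eqn_add2l.
  rewrite -/(shift (size c) (scat c e1) _) -/(shift (size c) (scat c _) _).
  by rewrite !shift_scat.
elim: f e => //= [t1 t2|t|f1 IH1 f2 IH2|f1 IH1 f2 IH2|f1 IH1 f2 IH2|f IHf|i f IHf|i f
  IHf] e.
- by case=> ? ?; rewrite !feval_tgen.
- by move=> ?; rewrite feval_tgen.
- by case=> /IH1 -> /IH2 ->.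
- by case=> /IH1 -> /IH2 ->.
- by case=> /IH1 -> /IH2 ->.
- by move=> /IHf ->.
- by move=> cf; apply: eq_exists => x; rewrite updE IHf.
- by move=> cf; apply: eq_forall => x; rewrite updE IHf.
Qed.

(** Predicates instead of formulas make the closure properties independent of syntax; the list [s]
    keeps track of the constants. *)
Definition Def s (P : (nat -> k) -> Prop) : Prop :=
  exists2 f, formula_over [set` s] f & P = fholds^~ f.

Lemma Def_ext s (P Q : (nat -> k) -> Prop) :
  (forall e, P e <-> Q e) -> Def s P -> Def s Q.
Proof. by move=> PQ; have -> : P = Q by apply/funext => e; apply/propext. Qed.

Lemma Def_mono s s' P : {subset s <= s'} -> Def s P -> Def s' P.
Proof. by move=> ss' [f sf ->]; exists f => //; apply: formula_over_sub sf => x /ss'. Qed.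

Lemma Def_fholds s f : formula_over [set` s] f -> Def s (fholds^~ f).
Proof. by move=> sf; exists f. Qed.

Lemma Def_eq s t1 t2 : term_over [set` s] t1 -> term_over [set` s] t2 ->
  Def s (fun e => feval e t1 = feval e t2).
Proof. by move=> s1 s2; exists (GRing.Equal t1 t2). Qed.

Lemma Def_eqv s i j : Def s (fun e => e i = e j).
Proof. exact: (@Def_eq s (GRing.Var k i) (GRing.Var k j)). Qed.

Lemma Def_prop s (Q : Prop) : Def s (fun=> Q).
Proof.
by exists (GRing.Bool `[< Q >]) => //=; apply/funext => e; apply/propext; apply: rwP;
  apply: asboolP.
Qed.

Lemma Def_not s P : Def s P -> Def s (fun e => ~ P e).
Proof. by case=> f sf ->; exists (GRing.Not f). Qed.

Lemma Def_and s P Q : Def s P -> Def s Q -> Def s (fun e => P e /\ Q e).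
Proof. by case=> f sf -> [g sg ->]; exists (GRing.And f g). Qed.

Lemma Def_or s P Q : Def s P -> Def s Q -> Def s (fun e => P e \/ Q e).
Proof. by case=> f sf -> [g sg ->]; exists (GRing.Or f g). Qed.

Lemma Def_imp s P Q : Def s P -> Def s Q -> Def s (fun e => P e -> Q e).
Proof. by case=> f sf -> [g sg ->]; exists (GRing.Implies f g). Qed.

Lemma Def_iff s P Q : Def s P -> Def s Q -> Def s (fun e => P e <-> Q e).
Proof. by move=> sP sQ; apply: Def_and; apply: Def_imp. Qed.

Lemma bounded_terms (g : nat -> GRing.term k) n :
  exists b, forall j, (j < n)%N -> (tbound (g j) <= b)%N.
Proof.
exists (\max_(i < n) tbound (g i)) => j jn.
exact: (leq_bigmax (Ordinal jn)).
Qed.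

Lemma Def_subs s P (g : nat -> GRing.term k) : (forall j, term_over [set` s] (g j)) ->
  Def s P -> Def s (fun e => P (fun j => feval e (g j))).
Proof.
move=> sg [f sf ->]; have [b Hb] := bounded_terms g (fbound f).
exists (fsubs b g f); first exact: formula_over_fsubs.
by apply/funext => e; rewrite fholds_fsubs.
Qed.

Lemma Def_comp s P (r : nat -> nat) : Def s P -> Def s (fun e => P (fun j => e (r j))).
Proof. by move=> sP; apply: (@Def_subs s P (fun j => GRing.Var k (r j))). Qed.

Lemma Def_ex s P : Def s P -> Def s (fun e => exists x, P (scons x e)).
Proof.
(* The variable 0 is renamed to [b]; the other variables of [f] are shifted down and stay below [b],
   so the binder captures none of them. *)
case=> f sf ->; pose b := fbound f.
pose g j := if j is j'.+1 then GRing.Var k j' else GRing.Var k b.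
have gb j : (j < fbound f)%N -> (tbound (g j) <= b.+1)%N.
  by case: j => [|j] //= /ltnW jf; rewrite leqW // ltnW.
exists (GRing.Exists b (fsubs b.+1 g f)).
  by apply: formula_over_fsubs => // -[].
apply/funext => e /=; apply: eq_exists => x; rewrite fholds_fsubs //.
apply: eq_fholds => -[|j] Hj; rewrite /= /upd ?eqxx //.
by rewrite ltn_eqF // ltnW.
Qed.

Lemma Def_all s P : Def s P -> Def s (fun e => forall x, P (scons x e)).
Proof.
move=> sP; apply: (@Def_ext _ (fun e => ~ exists x, ~ P (scons x e))) => [e|].
  split=> [H x|H [x]]; last by apply; apply: H.
  by apply: contrapT => nP; apply: H; exists x.
by apply: Def_not; apply: (@Def_ex s (fun e => ~ P e)); apply: Def_not.
Qed.

Lemma Def_exn s P n : Def s P -> Def s (fun e => exists2 c, size c = n & P (scat c e)).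
Proof.
elim: n P => [|n IHn] P sP.
  apply: Def_ext sP => e; split=> [Pe|]; first by exists [::].
  by case=> -[].
apply: Def_ext (IHn _ (Def_ex sP)) => e; split=> [[c cn [x Px]]|[[|x c] // [cn] Pc]].
  by exists (x :: c) => //=; rewrite cn.
by exists c => //; exists x.
Qed.

Lemma Def_alln s P n : Def s P -> Def s (fun e => forall c, size c = n -> P (scat c e)).
Proof.
move=> sP; apply: Def_ext (Def_not (Def_exn n (Def_not sP))) => e.
split=> [H c cn|H [c cn]]; last by apply; apply: H.
by apply: contrapT => nP; apply: H; exists c.
Qed.

Lemma Def_forall s n (P : nat -> (nat -> k) -> Prop) :
  (forall i, (i < n)%N -> Def s (P i)) ->
  Def s (fun e => forall i, (i < n)%N -> P i e).
Proof.
elim: n => [|n IHn] sP; first by apply: Def_ext (Def_prop s True) => e.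
apply: Def_ext (Def_and (IHn _) (sP n _)) => // [e|i Hi]; last exact/sP/ltnW.
split=> [[H Hn] i|H]; last by split=> [i Hi|]; apply: H => //; apply: ltnW.
by rewrite ltnS leq_eqVlt => /predU1P[->|/H].
Qed.

Lemma Def_exists s n (P : nat -> (nat -> k) -> Prop) :
  (forall i, (i < n)%N -> Def s (P i)) ->
  Def s (fun e => exists2 i, (i < n)%N & P i e).
Proof.
move=> sP; have := Def_not (@Def_forall s n (fun i e => ~ P i e) _).
move/(_ (fun i Hi => Def_not (sP i Hi))); apply: Def_ext => e; split=> [H|[i Hi Pi]].
  by apply: contrapT => nP; apply: H => i Hi Pi; apply: nP; exists i.
by move=> /(_ i Hi).
Qed.

End Formulas.
(** * Definable subsets of the line and their numbers *)

Section RingEvaluation.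
Variables (k : fieldType) (R : comNzRingType) (h : k -> R).

(** Only the value on [rterm]s matters. *)
Fixpoint teval (e : nat -> R) (t : GRing.term k) : R :=
  match t with
  | GRing.Var i => e i
  | GRing.Const c => h c
  | GRing.NatConst n => n%:R
  | GRing.Add t1 t2 => teval e t1 + teval e t2
  | GRing.Opp t1 => - teval e t1
  | GRing.NatMul t1 n => teval e t1 *+ n
  | GRing.Mul t1 t2 => teval e t1 * teval e t2
  | GRing.Inv _ => 0
  | GRing.Exp t1 n => teval e t1 ^+ n
  end.

Lemma teval_morph (phi : {rmorphism R -> k}) e t : (forall c, phi (h c) = c) ->
  GRing.rterm t -> phi (teval e t) = feval (phi \o e) t.
Proof.
move=> phih; elim: t => //= [n|t1 IH1 t2 IH2|t1 IH1|t1 IH1 n|t1 IH1 t2 IH2|t1 IH1 n].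
- by rewrite rmorph_nat.
- by case/andP=> /IH1 <- /IH2 <-; rewrite rmorphD.
- by move=> /IH1 <-; rewrite rmorphN.
- by move=> /IH1 <-; rewrite rmorphMn.
- by case/andP=> /IH1 <- /IH2 <-; rewrite rmorphM.
- by move=> /IH1 <-; rewrite rmorphXn.
Qed.

End RingEvaluation.

(** * Finite and cofinite sets with bounds on their size *)

Section SmallSets.
Variable T : eqType.
Implicit Types (X Y : T -> Prop) (s : seq T).

Definition small n X := exists2 s, (size s <= n)%N & forall x, X x -> x \in s.

Definition small_or_cosmall n X := small n X \/ small n (fun x => ~ X x).

Lemma small_sub m n X Y : (m <= n)%N -> (forall x, Y x -> X x) -> small m X -> small n Y.
Proof. by move=> mn YX [s sm Xs]; exists s; [apply: leq_trans mn|move=> x /YX/Xs]. Qed.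

Lemma small_or_cosmall_not n X :
  small_or_cosmall n X -> small_or_cosmall n (fun x => ~ X x).
Proof. by case=> sX; [right|left]; apply: small_sub sX => // x /contrapT. Qed.

Lemma small_or_cosmall_and m n X Y : small_or_cosmall m X -> small_or_cosmall n Y ->
  small_or_cosmall (m + n) (fun x => X x /\ Y x).
Proof.
case=> sX; first by left; apply: small_sub sX => [|x []//]; apply: leq_addr.
case=> sY; first by left; apply: small_sub sY => [|x []//]; apply: leq_addl.
right; have [[s sm Xs] [s' sn Ys]] := (sX, sY); exists (s ++ s').
  by rewrite size_cat leq_add.
move=> x /not_andP[/Xs|/Ys] xs; rewrite mem_cat xs //.
by rewrite orbT.
Qed.

Lemma uniq_size_of_mem s s' :
  uniq s -> uniq s' -> (forall x, x \in s <-> x \in s') -> size s = size s'.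
Proof.
move=> us us' H; apply: perm_size; apply: uniq_perm => // x.
by apply/idP/idP => /H.
Qed.

End SmallSets.

(** * Strong minimality and first-order definability of numbers *)

Section Numbers.
Variable k : closedFieldType.
Hypothesis k_char0 : [pchar k] =i pred0.
Implicit Types (e : nat -> k) (t : GRing.term k) (f : GRing.formula k).
Implicit Types (c s : seq k) (x : k).

Lemma natr_inj : injective (fun n => n%:R : k).
Proof.
have nat0 n : (n%:R == 0 :> k) = (n == 0)%N by have /pcharf0P -> := k_char0.
move=> m n; wlog le_mn : m n / (m <= n)%N => [W|/= mn].
  by have [/W //|/ltnW/W H /esym/H] := leqP m n.
apply/eqP; rewrite eqn_leq le_mn -subn_eq0 -nat0 natrB //=.
by rewrite subr_eq0 mn.
Qed.

Lemma fresh s : exists x, x \notin s.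
Proof.
apply: contrapT => H.
have sub : {subset [seq n%:R : k | n <- iota 0 (size s).+1] <= s}.
  by move=> x _; apply: contrapT => /negP xs; apply: H; exists x.
have := uniq_leq_size _ sub; rewrite (map_inj_uniq natr_inj) iota_uniq size_map size_iota.
by rewrite ltnn => /(_ isT).
Qed.

Lemma seq_of_roots (p : {poly k}) : p != 0 ->
  exists2 s, (size s <= size p)%N & forall x, root p x -> x \in s.
Proof.
move=> p0; have [s Ep] := closed_field_poly_normal p.
have lp0 : lead_coef p != 0 by rewrite lead_coef_eq0.
exists s => [|x]; last by rewrite {1}Ep rootZ // root_prod_XsubC.
by rewrite [p]Ep size_scale // size_prod_XsubC.
Qed.

Lemma fholds_qe f : exists2 g,
  GRing.qf_form g && GRing.rformula g & forall e, fholds e g <-> fholds e f.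
Proof.
pose closedk : GRing.closed_field_axiom k := @solve_monicpoly k.
pose g := GRing.quantifier_elim (@ClosedFieldQE.ex_elim k) (GRing.to_rform f).
have gwf : GRing.qf_form g && GRing.rformula g.
  apply: (GRing.quantifier_elim_wf (@ClosedFieldQE.wf_ex_elim k)).
  exact: GRing.to_rform_rformula.
(* Truncating environments at [n] loses nothing, as no variable of either formula reaches [n]. *)
exists g => // e; pose n := maxn (fbound f) (fbound g).
have mkE f1 : (fbound f1 <= n)%N -> fholds e f1 = GRing.holds (mkseq e n) f1.
  move=> f1n; rewrite -fholds_nth; apply: eq_fholds => j jf1.
  by rewrite nth_mkseq // (leq_trans jf1).
rewrite !mkE ?leq_maxl ?leq_maxr //.
have [gqf _] := andP gwf.
split=> [/(GRing.qf_evalP _ gqf)|].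
  move/(GRing.quantifier_elim_rformP (@ClosedFieldQE.wf_ex_elim k)
    (ClosedFieldQE.holds_ex_elim closedk) _ (GRing.to_rform_rformula f)).
  by move/GRing.to_rformP.
move=> /GRing.to_rformP /(GRing.quantifier_elim_rformP (@ClosedFieldQE.wf_ex_elim k)
    (ClosedFieldQE.holds_ex_elim closedk) _ (GRing.to_rform_rformula f)).
by move/(GRing.qf_evalP _ gqf).
Qed.

(** Once the variables other than 0 are frozen, an inverse-free term is a polynomial in the variable
    0. *)
Definition fiber_env e : nat -> {poly k} := fun j => if j is j'.+1 then (e j')%:P else 'X.

Lemma horner_fiber e t x : GRing.rterm t ->
  (teval polyC (fiber_env e) t).[x] = feval (scons x e) t.
Proof.
move=> rt; rewrite -/(horner_eval x _) teval_morph // => [|c]; last exact: hornerC.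
by apply: eq_feval => -[|j] _ /=; rewrite /horner_eval ?hornerX ?hornerC.
Qed.

(** The degree in the variable 0 is read off the term, since [e] only enters the coefficients.
    [fiber_bound] owes its uniformity to this. *)
Lemma size_fiber t : exists n, forall e, (size (teval polyC (fiber_env e) t) <= n)%N.
Proof.
elim: t => [i|c|n|t1 [n IH1] t2 [m IH2]|t1 [n IH1]|t1 [n IH1] m|t1 [n IH1] t2 [m IH2]|t1
  IH1|t1 [n IH1] m] /=.
- by exists 2 => e; case: i => [|i] /=;
    rewrite ?size_polyX // (leq_trans (size_polyC_leq1 _)).
- by exists 1%N => e; apply: size_polyC_leq1.
- by exists 1%N => e; rewrite -polyC_natr size_polyC_leq1.
- exists (maxn n m) => e; apply: leq_trans (size_polyD _ _) _.
  by rewrite geq_max !leq_max IH1 IH2 orbT.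
- by exists n => e; rewrite size_polyN.
- by exists n => e; rewrite -scaler_nat (leq_trans (size_scale_leq _ _)).
- exists (n + m)%N => e; apply: leq_trans (size_polyMleq _ _) _.
  by apply: leq_trans (leq_pred _) _; apply: leq_add.
- by exists 0 => e; rewrite size_poly0.
- exists (n * m).+1%N => e; apply: leq_trans (size_poly_exp_leq _ _) _.
  by rewrite ltnS leq_mul2r (leq_trans (leq_pred _)) ?IH1 ?orbT.
Qed.

(** After quantifier elimination an atom is a polynomial equation in one unknown, either trivial or
    with no more roots than the size of the polynomial; under binary connectives the bounds add
    up. *)
Lemma fiber_bound s P : Def s P ->
  exists n, forall e, small_or_cosmall n (fun x => P (scons x e)).
Proof.
case=> f _ -> {s P}; have [g /andP[gqf grf] gf] := fholds_qe f.
suff [n Hn] : exists n, forall e, small_or_cosmall n (fun x => fholds (scons x e) g).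
  exists n => e; have := Hn e; congr small_or_cosmall.
  by apply/funext => x; apply/propext.
elim: g gqf grf {gf} => //= [b|t1 t2|g1 IH1 g2 IH2|g1 IH1 g2 IH2|g1 IH1 g2 IH2|g IHg].
- by move=> _ _; exists 0 => e; case: b; [right|left]; exists [::].
- move=> _ /andP[rt1 rt2]; have [[n Hn] [m Hm]] := (size_fiber t1, size_fiber t2).
  exists (maxn n m) => e.
  pose p := teval polyC (fiber_env e) t1 - teval polyC (fiber_env e) t2.
  have pE x : (p.[x] = 0) <-> (feval (scons x e) t1 = feval (scons x e) t2).
    rewrite /p hornerD hornerN !horner_fiber //.
    by split=> [/eqP|->]; rewrite ?subr_eq0 ?subrr // => /eqP.
  have [p0|/seq_of_roots[s sp Hs]] := eqVneq p 0.
    by right; exists [::] => // x []; apply/pE; rewrite p0 horner0.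
  left; exists s => [|x /pE px]; last by apply: Hs; apply/eqP.
  apply: leq_trans sp (leq_trans (size_polyD _ _) _).
  by rewrite size_polyN geq_max !leq_max Hn Hm orbT.
- move=> /andP[/IH1 {}IH1 /IH2 {}IH2] /andP[/IH1[n Hn] /IH2[m Hm]].
  by exists (n + m)%N => e; apply: small_or_cosmall_and.
- move=> /andP[/IH1 {}IH1 /IH2 {}IH2] /andP[/IH1[n Hn] /IH2[m Hm]].
  exists (n + m)%N => e.
  have /small_or_cosmall_not := small_or_cosmall_and
    (small_or_cosmall_not (Hn e)) (small_or_cosmall_not (Hm e)).
  congr small_or_cosmall; apply/funext => x; apply/propext.
  by rewrite not_andP !notK.
- move=> /andP[/IH1 {}IH1 /IH2 {}IH2] /andP[/IH1[n Hn] /IH2[m Hm]].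
  exists (n + m)%N => e.
  have /small_or_cosmall_not := small_or_cosmall_and (Hn e) (small_or_cosmall_not (Hm e)).
  congr small_or_cosmall; apply/funext => x; apply/propext.
  by rewrite not_andP notK implyE.
- by move=> /IHg {}IHg /IHg[n Hn]; exists n => e; apply: small_or_cosmall_not.
Qed.

(** The offset in the cofinite case keeps the whole line, numbered -1, apart from the empty set,
    numbered 0. *)
Definition has_number (X : k -> Prop) (b : k) : Prop :=
  exists2 s, uniq s &
    ((forall x, X x <-> x \in s) /\ b = (size s)%:R) \/
    ((forall x, X x <-> x \notin s) /\ b = - (size s).+1%:R).

Lemma not_finite_cofinite s s' : ~ (forall x, x \in s <-> x \notin s').
Proof.
move=> H; have [x] := fresh (s ++ s'); rewrite mem_cat negb_or => /andP[/negP xs xs'].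
by apply: xs; apply/H.
Qed.

Lemma has_number_uniq (X : k -> Prop) b b' : has_number X b -> has_number X b' -> b = b'.
Proof.
case=> s us [[Xs ->]|[Xs ->]] [s' us' [[Xs' ->]|[Xs' ->]]].
- by rewrite (@uniq_size_of_mem _ s s') // => x; rewrite -Xs -Xs'.
- by case: (@not_finite_cofinite s s') => x; rewrite -Xs -Xs'.
- by case: (@not_finite_cofinite s' s) => x; rewrite -Xs -Xs'.
- rewrite (@uniq_size_of_mem _ s s') // => x.
  by split; apply: contraTT => ?; [apply/Xs/Xs'|apply/Xs'/Xs].
Qed.

Lemma small_finite n (X : k -> Prop) : small n X ->
  exists2 s, uniq s & forall x, X x <-> x \in s.
Proof.
case=> s _ Xs; exists (undup [seq x <- s | `[< X x >]]); first exact: undup_uniq.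
move=> x; rewrite mem_undup mem_filter; split=> [Xx|/andP[/asboolP]//].
by rewrite Xs // andbT; apply/asboolP.
Qed.

Lemma finite_or_cofinite n (X : k -> Prop) : small_or_cosmall n X ->
  exists2 s, uniq s & (forall x, X x <-> x \in s) \/ (forall x, X x <-> x \notin s).
Proof.
case=> /small_finite[s us Xs]; exists s => //; first by left.
right=> x; split=> [Xx|/negP]; first by apply/negP => /Xs.
by move=> xs; apply: contrapT => /Xs.
Qed.

Lemma has_number_ex n (X : k -> Prop) : small_or_cosmall n X -> exists b, has_number X b.
Proof.
case/finite_or_cofinite=> s us [|] Xs.
  by exists (size s)%:R, s => //; left.
by exists (- (size s).+1%:R), s => //; right.
Qed.

(** Since [k] is infinite, [s] must enumerate whichever of [X] and its complement is small. *)
Lemma small_or_cosmall_size n (X : k -> Prop) s : small_or_cosmall n X -> uniq s ->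
  (forall x, X x <-> x \in s) \/ (forall x, X x <-> x \notin s) -> (size s <= n)%N.
Proof.
move=> sX us Xs.
have infin m Y : (forall x, Y x <-> x \notin s) -> small m Y -> False.
  move=> Ys [s' _ Hs']; have [x] := fresh (s ++ s'); rewrite mem_cat negb_or.
  by case/andP=> /Ys/Hs' ->.
have fin Y : (forall x, Y x <-> x \in s) -> small n Y -> (size s <= n)%N.
  move=> Ys [s' s'n Hs']; apply: leq_trans s'n; apply: uniq_leq_size => // x.
  by move=> /Ys/Hs'.
have notE b : (~ ~~ b) <-> b by split=> [/negP/negPn|->].
case: sX Xs => sX [] Xs.
- exact: fin sX.
- by case: (infin _ _ Xs sX).
- by case: (infin _ (fun x => ~ X x) _ sX) => x; rewrite Xs; split=> /negP.
- by apply: fin sX => x; rewrite Xs.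
Qed.

(** Quantifying over lists of arbitrary length is not first-order. By [fiber_bound] the lengths up
    to [N] suffice, and each of them is a block of object quantifiers. *)
Lemma Def_has_number s P : Def s P ->
  Def s (fun e => has_number (fun x => P (scons x (shift 1 e))) (e 0)).
Proof.
move=> sP; have [N HN] := fiber_bound sP.
pose listed n e x := exists2 i, (i < n)%N & x = e i.
(* In [Q n] the variables below [n] list the elements, the variable [n] is the number, and the
   parameters follow. *)
pose Q n e := (forall i, (i < n)%N -> forall j, (j < n)%N -> e i = e j -> i = j) /\
  (((forall x, P (scons x (shift n.+1 e)) <-> listed n e x) /\ e n = n%:R) \/
   ((forall x, P (scons x (shift n.+1 e)) <-> ~ listed n e x) /\ e n = - n.+1%:R)).
have sQ n : Def s (Q n).
  have sP' : Def s (fun e => P (scons (e 0) (shift n.+2 e))).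
    apply: Def_ext (Def_comp (fun j => if j is j'.+1 then (n.+2 + j')%N else 0%N) sP) =>
      e.
    by have -> : scons (e 0) (shift n.+2 e) =
      fun j => e (if j is j'.+1 then (n.+2 + j')%N else 0%N) by apply/funext => -[].
  have sl : Def s (fun e => exists2 i, (i < n)%N & e 0 = e i.+1).
    by apply: Def_exists => i _; apply: Def_eqv.
  apply: Def_and; last apply: Def_or.
  - apply: Def_forall => i _; apply: Def_forall => j _.
    by apply: Def_imp; [apply: Def_eqv|apply: Def_prop].
  - apply: Def_and; first exact: Def_all (Def_iff sP' sl).
    exact: (@Def_eq _ _ (GRing.Var k n) (GRing.NatConst k n)).
  - apply: Def_and; first exact: Def_all (Def_iff sP' (Def_not sl)).
    exact: (@Def_eq _ _ (GRing.Var k n) (GRing.Opp (GRing.NatConst k n.+1))).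
have QE e c : Q (size c) (scat c e) <-> uniq c /\
   ((((forall x, P (scons x (shift 1 e)) <-> x \in c)) /\ e 0 = (size c)%:R) \/
    (((forall x, P (scons x (shift 1 e)) <-> x \notin c)) /\ e 0 = - (size c).+1%:R)).
  have listedE x : listed (size c) (scat c e) x <-> x \in c.
    split=> [[i ic ->]|xc]; first by rewrite scat_lt ?mem_nth.
    by exists (index x c); rewrite ?scat_lt ?index_mem ?nth_index.
  have shiftE : shift (size c).+1 (scat c e) = shift 1 e.
    by apply/funext => j; rewrite -[in RHS](shift_scat e (erefl (size c))) /shift addnA
      addn1.
  have cE : scat c e (size c) = e 0.
    by rewrite -[in RHS](shift_scat e (erefl (size c))) /shift addn0.
  have uE : uniq c <-> forall i, (i < size c)%N -> forall j, (j < size c)%N ->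
      scat c e i = scat c e j -> i = j.
    split=> [/(uniqP 0) H i ic j jc|H]; first by rewrite !scat_lt //; apply: H.
    by apply/(uniqP 0) => i j ic jc ?; apply: H; rewrite ?scat_lt.
  rewrite /Q shiftE cE -uE.
  have -> : (forall x, P (scons x (shift 1 e)) <-> listed (size c) (scat c e) x) =
            (forall x, P (scons x (shift 1 e)) <-> x \in c).
    by apply: eq_forall => x; apply/propext; rewrite listedE.
  have -> : (forall x, P (scons x (shift 1 e)) <-> ~ listed (size c) (scat c e) x) =
            (forall x, P (scons x (shift 1 e)) <-> x \notin c) => //.
  apply: eq_forall => x; apply/propext; rewrite listedE.
  by have -> : (~ x \in c) = (x \notin c) by apply/propext; split=> /negP.
have sD : forall n, (n < N.+1)%N -> Def s
  (fun e => exists2 c, size c = n & Q n (scat c e)).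
  by move=> n _; apply: Def_exn.
apply: Def_ext (Def_exists sD) => e; split.
  by case=> n _ [c <- /QE[uc Hc]]; exists c.
case=> c uc Hc; exists (size c); last by exists c => //; apply/QE.
rewrite ltnS; apply: (@small_or_cosmall_size _ (fun x => P (scons x (shift 1 e))) c) =>
  //.
by case: Hc => -[? _]; [left|right].
Qed.

End Numbers.

(** * Definable bijections between cofinite subsets of the line *)

Section Cofinitely.
Variable T : eqType.
Implicit Types X Y : T -> Prop.

Definition cof X := exists s : seq T, forall x, x \notin s -> X x.

(** The dual of the filter [cof]. It distributes over disjunctions, so if a product vanishes
    infinitely often, one of its factors does. *)
Definition infinitely X := ~ cof (fun x => ~ X x).

Lemma cof_notin (s : seq T) : cof (fun x => x \notin s).
Proof. by exists s. Qed.

Lemma cof_true X : (forall x, X x) -> cof X.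
Proof. by move=> HX; exists [::]. Qed.

Lemma cof_sub X Y : (forall x, X x -> Y x) -> cof X -> cof Y.
Proof. by move=> XY [s Xs]; exists s => x /Xs/XY. Qed.

Lemma cof_and X Y : cof X -> cof Y -> cof (fun x => X x /\ Y x).
Proof.
move=> [s Xs] [s' Ys]; exists (s ++ s') => x.
by rewrite mem_cat negb_or => /andP[/Xs ? /Ys].
Qed.

Lemma cof_all (U : eqType) (l : seq U) (F : U -> T -> Prop) :
  (forall u, u \in l -> cof (F u)) -> cof (fun x => forall u, u \in l -> F u x).
Proof.
elim: l => [|u l IHl] H; first exact: cof_true.
have := cof_and (H u (mem_head _ _))
  (IHl (fun v (vl : v \in behead (u :: l)) => H v (mem_behead vl))).
by apply: cof_sub => x [Fu Fl] v; rewrite inE => /predU1P[->|/Fl].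
Qed.

Lemma infinitely_meet X Y : infinitely X -> cof Y -> exists x, X x /\ Y x.
Proof.
move=> iX cY; apply: contrapT => H; apply: iX; apply: cof_sub cY => x Yx Xx.
by apply: H; exists x.
Qed.

Lemma infinitely_or X Y Z : (forall x, X x -> Y x \/ Z x) ->
  infinitely X -> infinitely Y \/ infinitely Z.
Proof.
move=> XYZ iX; apply: contrapT => /not_orP[/contrapT cY /contrapT cZ].
by apply: iX; apply: cof_sub (cof_and cY cZ) => x [nY nZ] /XYZ[].
Qed.

End Cofinitely.

Section Moebius.
Variable k : closedFieldType.
Hypothesis k_char0 : [pchar k] =i pred0.
Implicit Types (x y : k) (p a b : {poly k}) (P Q : {poly {poly k}}).

Lemma cof_infinitely (X : k -> Prop) : cof X -> infinitely X.
Proof.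
move=> [s Xs] [s' Hs']; have [x] := fresh k_char0 (s ++ s').
by rewrite mem_cat negb_or => /andP[/Xs ? /Hs'].
Qed.

Lemma cof_meet (X : k -> Prop) : cof X -> exists x, X x.
Proof.
move=> cX; have [x []] := infinitely_meet (cof_infinitely cX) cX; by exists x.
Qed.

Lemma cof_nonroot p : p != 0 -> cof (fun x => p.[x] != 0).
Proof. by case/seq_of_roots=> s _ Hs; exists s => x; apply: contra => /Hs. Qed.

Lemma deriv_eq0_size (R : idomainType) (q : {poly R}) :
  [pchar R] =i pred0 -> q^`() = 0 -> (size q <= 1)%N.
Proof.
move=> /pcharf0P R0 q0; apply/leq_sizeP => -[|j] // _.
have /eqP := congr1 (fun r : {poly R} => r`_j) q0.
by rewrite coef_deriv coef0 -mulr_natr mulf_eq0 R0 orbF => /eqP.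
Qed.

Lemma two_roots p : (2 < size p)%N ->
  exists x y, [/\ root p x, root p y & x = y -> root p^`() x].
Proof.
move=> p2; have [x px] := closed_rootP p (negbT (gtn_eqF (ltnW p2))).
have [q pq] := factor_theorem p x px.
have q0 : q != 0 by apply: contraTneq p2 => q0; rewrite pq q0 mul0r size_poly0.
have q1 : (1 < size q)%N by move: p2;
  rewrite pq size_Mmonic ?monicXsubC // size_XsubC addn2.
have [y qy] := closed_rootP q (negbT (gtn_eqF q1)).
exists x, y; split=> // [|xy]; first by rewrite pq rootM qy.
rewrite pq derivM rootE hornerD !hornerM hornerXsubC subrr mulr0 add0r.
by move: qy; rewrite -xy => /rootP ->; rewrite mul0r.
Qed.

(** The outer indeterminate stands for [y], the inner one for [x]; thus [size] measures the degree
    in [y], and resultants eliminate [y]. *)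
Definition ev x y P : k := P.[y%:P].[x].

Definition specialize x P : {poly k} := map_poly (horner_eval x) P.

Lemma horner_specialize x y P : (specialize x P).[y] = ev x y P.
Proof.
by rewrite /specialize -{1}[y](hornerC y x) -/(horner_eval x y%:P) horner_map.
Qed.

Lemma evM x y P Q : ev x y (P * Q) = ev x y P * ev x y Q.
Proof. by rewrite /ev !hornerM. Qed.

Lemma evD x y P Q : ev x y (P + Q) = ev x y P + ev x y Q.
Proof. by rewrite /ev !hornerD. Qed.

Lemma evC x y p : ev x y p%:P = p.[x].
Proof. by rewrite /ev hornerC. Qed.

Lemma evZ x y p P : ev x y (p *: P) = p.[x] * ev x y P.
Proof. by rewrite -mul_polyC evM evC. Qed.

Lemma size_specialize x P : (lead_coef P).[x] != 0 -> size (specialize x P) = size P.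
Proof. by move=> lP; apply: size_map_poly_id0. Qed.

Lemma ev_deriv x y P : ev x y P^`() = (specialize x P)^`().[y].
Proof. by rewrite -horner_specialize /specialize deriv_map. Qed.

Definition pair_env x y : nat -> k := scat [:: x; y] (fun=> 0).

(** By quantifier elimination only the vanishing pattern of finitely many polynomials matters.
    Moving [G] between points with the same pattern takes the place of an argument with types. *)
Lemma Def_polys s (G : (nat -> k) -> Prop) : Def s G ->
  exists L : seq {poly {poly k}}, forall x y x' y',
    (forall P, P \in L -> (ev x y P = 0 <-> ev x' y' P = 0)) ->
    G (pair_env x y) -> G (pair_env x' y').
Proof.
case=> f _ ->; have [g /andP[gqf grf] gf] := fholds_qe f.
suff [L HL] : exists L : seq {poly {poly k}}, forall x y x' y',
    (forall P, P \in L -> (ev x y P = 0 <-> ev x' y' P = 0)) ->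
    (fholds (pair_env x y) g <-> fholds (pair_env x' y') g).
  by exists L => x y x' y' /HL H; rewrite -!gf => /H.
elim: g gqf grf {gf} => //= [b|t1 t2|g1 IH1 g2 IH2|g1 IH1 g2 IH2|g1 IH1 g2 IH2|g IHg].
- by exists [::].
- move=> _ /andP[rt1 rt2].
  pose h := fun c : k => c%:P%:P; pose E : nat -> {poly {poly k}} := nth 0 [:: 'X%:P; 'X].
  have evE x y t : GRing.rterm t -> ev x y (teval h E t) = feval (pair_env x y) t.
    move=> rt; rewrite -[LHS]/((horner_eval x \o horner_eval y%:P) (teval h E t)).
    rewrite teval_morph // => [|c]; last by rewrite /= /horner_eval !hornerC.
    apply: eq_feval => -[|[|j]] _ /=; rewrite /horner_eval ?hornerC ?hornerX ?hornerC //.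
    by rewrite /E nth_default // !horner0.
  exists [:: teval h E t1 - teval h E t2] => x y x' y' /(_ _ (mem_head _ _)).
  have evB x1 y1 : (ev x1 y1 (teval h E t1 - teval h E t2) = 0) <->
      (feval (pair_env x1 y1) t1 = feval (pair_env x1 y1) t2).
    rewrite -!evE // /ev !hornerD !hornerN.
    by split=> [/eqP|->]; rewrite ?subr_eq0 ?subrr // => /eqP.
  by rewrite !evB.
- move=> /andP[/IH1 {}IH1 /IH2 {}IH2] /andP[/IH1[L1 H1] /IH2[L2 H2]].
  exists (L1 ++ L2) => x y x' y' HL.
  by rewrite (H1 x y x' y') ?(H2 x y x' y') // => P PL; apply: HL;
    rewrite mem_cat PL ?orbT.
- move=> /andP[/IH1 {}IH1 /IH2 {}IH2] /andP[/IH1[L1 H1] /IH2[L2 H2]].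
  exists (L1 ++ L2) => x y x' y' HL.
  by rewrite (H1 x y x' y') ?(H2 x y x' y') // => P PL; apply: HL;
    rewrite mem_cat PL ?orbT.
- move=> /andP[/IH1 {}IH1 /IH2 {}IH2] /andP[/IH1[L1 H1] /IH2[L2 H2]].
  exists (L1 ++ L2) => x y x' y' HL.
  by rewrite (H1 x y x' y') ?(H2 x y x' y') // => P PL; apply: HL;
    rewrite mem_cat PL ?orbT.
- by move=> /IHg {}IHg /IHg[L HL]; exists L => x y x' y' /HL H; rewrite H.
Qed.

(** * Definable functions are generically rational *)

Section GenericRationality.
Variables (L : seq {poly {poly k}}) (G : k -> k -> Prop) (phi : k -> k) (S : seq k).
Hypothesis G_polys : forall x y x' y',
  (forall P, P \in L -> (ev x y P = 0 <-> ev x' y' P = 0)) -> G x y -> G x' y'.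
Hypothesis G_graph : forall x, x \notin S -> forall y, G x y <-> y = phi x.

Definition vanishing Q := Q != 0 /\ infinitely (fun x => ev x (phi x) Q = 0).

(** If no nonzero member of [L] vanished at [(x, phi x)], then [G x] would
    contain every generic [y]. *)
Lemma vanishing_ex : exists Q, vanishing Q.
Proof.
exists (\prod_(P <- L | P != 0) P); split.
  by rewrite prodf_seq_neq0; apply/allP => P _; apply/implyP.
apply: cof_infinitely.
have cL : cof (fun x => forall P, P \in [seq P <- L | P != 0] -> (lead_coef P).[x] != 0).
  apply: cof_all => P; rewrite mem_filter => /andP[P0 _].
  by apply: cof_nonroot; rewrite lead_coef_eq0.
apply: cof_sub (cof_and cL (cof_notin S)) => x [Lx Sx].
apply: contrapT => /eqP; rewrite -big_filter => nz.
have nzL P : P \in [seq P <- L | P != 0] -> ev x (phi x) P != 0.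
  move=> PL; apply: contra nz => /eqP P0.
  by rewrite (big_rem P) //= evM P0 mul0r.
have cy : cof (fun y => forall P, P \in [seq P <- L | P != 0] -> ev x y P != 0).
  apply: cof_all => P PL.
  apply: cof_sub (@cof_nonroot (specialize x P) _) => [y|];
    first by rewrite horner_specialize.
  by rewrite -size_poly_gt0 size_specialize ?Lx // size_poly_gt0; move: PL;
    rewrite mem_filter => /andP[].
have [y [Ly]] := cof_meet (cof_and cy (cof_notin [:: phi x])).
rewrite inE => /eqP; apply; apply/(G_graph Sx); apply: (@G_polys x (phi x));
  last exact/G_graph.
move=> P PL; have [->|P0] := eqVneq P 0; first by rewrite /ev !horner0.
have PL' : P \in [seq P <- L | P != 0] by rewrite mem_filter P0.
by split=> /eqP H; [have := nzL _ PL'|have := Ly _ PL']; rewrite H.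
Qed.

(** This [Q] plays the role of the minimal polynomial of [phi x] over [k(x)]. *)
Lemma vanishing_min :
  exists2 Q, vanishing Q & forall P, vanishing P -> (size Q <= size P)%N.
Proof.
have : exists n, `[< exists2 Q, vanishing Q & size Q = n >].
  by have [Q vQ] := vanishing_ex; exists (size Q); apply/asboolP; exists Q.
case/ex_minnP=> n /asboolP[Q vQ <-] Qmin; exists Q => // P vP.
by apply: Qmin; apply/asboolP; exists P.
Qed.

Section Minimal.
Variable Q : {poly {poly k}}.
Hypothesis Q_vanishing : vanishing Q.
Hypothesis Q_min : forall P, vanishing P -> (size Q <= size P)%N.

Let Q_neq0 : Q != 0. Proof. by case: Q_vanishing. Qed.

Lemma minimal_size_gt1 : (1 < size Q)%N.
Proof.
rewrite ltnNge; apply/negP => /size1_polyC EQ; have [Q0 Qinf] := Q_vanishing.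
move: Q0; rewrite EQ polyC_eq0 => q0.
have [x []] := infinitely_meet Qinf (cof_nonroot q0).
by rewrite [in ev _ _ _]EQ evC => ->; rewrite eqxx.
Qed.

(** A Bezout identity over [k(x)] with cleared denominators: [r] is a polynomial in [x] alone. *)
Definition comaximal P := exists r u v, r != 0 /\ r%:P = u * Q + v * P.

(** A minimal [Q] is irreducible over the fraction field [k(x)]. *)
Lemma multiple_or_comaximal P :
  (exists c E, c != 0 /\ c *: P = E * Q) \/ comaximal P.
Proof.
have [->|P0] := eqVneq P 0.
  by left; exists 1, 0; rewrite oner_neq0 scaler0 mul0r.
have [P1|P1] := leqP (size P) 1.
  right; exists P`_0, 0, 1; rewrite mul0r mul1r add0r -size1_polyC //; split=> //.
  by move: P0; rewrite (size1_polyC P1) polyC_eq0 coefC.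
have Q1 := minimal_size_gt1.
have [res0|res0] := eqVneq (resultant Q P) 0; last first.
  by right; have [[u v] /= _ E] := resultant_in_ideal Q1 P1; exists (resultant Q P), u, v.
left; have D1 : (1 < size (gcdp Q P))%N by rewrite -resultant_eq0 res0.
have /Pdiv.WeakIdomain.dvdpP[[c E] /= c0 cE] := dvdp_gcdl Q P.
have cQ0 : c *: Q != 0 by rewrite scale_poly_eq0 negb_or c0.
move: cQ0; rewrite cE mulf_eq0 negb_or => /andP[E0 D0].
have sQ : size Q = (size E + size (gcdp Q P)).-1 by rewrite -size_mul // -cE size_scale.
(* The factor vanishing infinitely often cannot be [E], whose degree in [y] is less than that of
   [Q]; so it is the gcd, which then has the degree of [Q]. *)
have [iE|iD] : infinitely (fun x => ev x (phi x) E = 0) \/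
               infinitely (fun x => ev x (phi x) (gcdp Q P) = 0).
- apply: infinitely_or (proj2 Q_vanishing) => x Qx.
  have /eqP : ev x (phi x) (c *: Q) = 0 by rewrite evZ Qx mulr0.
  by rewrite cE evM mulf_eq0 => /orP[] /eqP; [left|right].
- have := Q_min (conj E0 iE); rewrite sQ.
  by case: (size (gcdp Q P)) D1 => [|[|d]] // _; rewrite !addnS /= -addSn ltnNge leq_addr.
have sD : size (gcdp Q P) = size Q.
  apply/eqP; rewrite eqn_leq (Q_min (conj D0 iD)) andbT.
  by rewrite dvdp_leq ?dvdp_gcdl.
have /eqp_dvdl EQ : gcdp Q P %= Q by rewrite -dvdp_size_eqp ?dvdp_gcdl ?sD.
have /Pdiv.WeakIdomain.dvdpP[[d F] /= d0 dF] : Q %| P by rewrite -EQ dvdp_gcdr.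
by exists d, F.
Qed.

(** Away from the zeros of [r], resp. [c], whether [P] vanishes at a zero of [Q] does not depend on
    that zero: all generic zeros of [Q] have the same vanishing pattern. *)
Lemma cof_comaximal P :
  cof (fun x => forall y, ev x y Q = 0 -> (ev x y P = 0 <-> ~ comaximal P)).
Proof.
have [mP|nP] := pselect (comaximal P).
  have [r [u [v [r0 rE]]]] := mP.
  apply: cof_sub (cof_nonroot r0) => x rx y Qy; split=> // Py; move: rx.
  by rewrite -(evC x y) rE evD !evM Qy Py !mulr0 addr0 eqxx.
have [[c [E [c0 cE]]]|//] := multiple_or_comaximal P.
apply: cof_sub (cof_nonroot c0) => x cx y Qy; split=> // _.
have /eqP : ev x y (c *: P) = 0 by rewrite cE evM Qy mulr0.
by rewrite evZ mulf_eq0 (negbTE cx) => /eqP.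
Qed.

(** Some generic zero of [Q] is a point of the graph; the others share its pattern with respect to
    [L], so [G] holds there too. *)
Lemma cof_graph : cof (fun x => forall y, ev x y Q = 0 -> y = phi x).
Proof.
have cL := @cof_all _ _ L _ (fun P _ => cof_comaximal P).
have [x0 [Qx0 [Lx0 Sx0]]] := infinitely_meet (proj2 Q_vanishing)
  (cof_and cL (cof_notin S)).
apply: cof_sub (cof_and cL (cof_notin S)) => x [Lx Sx] y Qy.
apply/(G_graph Sx); apply: (@G_polys x0 (phi x0)); last exact/G_graph.
by move=> P PL; rewrite (Lx0 P PL _ Qx0) (Lx P PL _ Qy).
Qed.

(** Otherwise [Q] has two roots over a generic [x], counted with multiplicity. They coincide by
    [cof_graph], so [Q] and its derivative have a common zero, although in characteristic zero the
    two are comaximal. *)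
Lemma minimal_size : size Q = 2.
Proof.
have Q1 := minimal_size_gt1.
apply/eqP; rewrite eqn_leq Q1 andbT leqNgt; apply/negP => Q2.
have pk0 : [pchar {poly k}] =i pred0 by move=> p; rewrite pchar_poly; apply: k_char0.
have dQ0 : Q^`() != 0.
  by apply: contraTneq Q1 => /(deriv_eq0_size pk0); rewrite ltnNge => ->.
have [[c [E [c0 cE]]]|[r [u [v [r0 rE]]]]] := multiple_or_comaximal Q^`().
  have : c *: Q^`() != 0 by rewrite scale_poly_eq0 negb_or c0.
  rewrite cE mulf_eq0 negb_or => /andP[E0 _].
  have := lt_size_deriv Q_neq0; rewrite -(size_scale _ c0) cE size_mul //.
  by rewrite -size_poly_gt0 in E0; case: (size E) E0 => // n _;
    rewrite addSn /= ltnNge leq_addl.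
have lQ : lead_coef Q != 0 by rewrite lead_coef_eq0.
have [x [gx [rx lx]]] := cof_meet
  (cof_and cof_graph (cof_and (cof_nonroot r0) (cof_nonroot lQ))).
have := Q2; rewrite -(size_specialize lx) => /two_roots[y1 [y2 []]].
rewrite !rootE !horner_specialize -ev_deriv => /eqP Qy1 /eqP Qy2 dQy1.
have y12 : y1 = y2 by rewrite (gx _ Qy1) (gx _ Qy2).
have /eqP dQ := dQy1 y12.
by move: rx; rewrite -(evC x y1) rE evD !evM Qy1 dQ !mulr0 addr0 eqxx.
Qed.

End Minimal.

(** Solve the linear equation given by [Q] for [y], and cancel the gcd of its two coefficients. *)
Lemma generic_rational : exists a b, [/\ b != 0, coprimep a b &
  cof (fun x => b.[x] != 0 /\ phi x = a.[x] / b.[x])].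
Proof.
have [Q vQ Qmin] := vanishing_min; have sQ := minimal_size vQ Qmin.
have [Q0 Qinf] := vQ.
have evQ x y : ev x y Q = (Q`_0).[x] + (Q`_1).[x] * y.
  rewrite -[Q in LHS]coefK sQ poly_def !big_ord_recl big_ord0 addr0 /=.
  by rewrite expr0 alg_polyC evD evC evZ /bump /= expr1 /ev hornerX hornerC.
have b0 : Q`_1 != 0 by move: Q0; rewrite -lead_coef_eq0 lead_coefE sQ.
pose g := gcdp (- Q`_0) Q`_1.
have g0 : g != 0 by rewrite gcdp_eq0 negb_and b0 orbT.
have Ea : - Q`_0 = (- Q`_0 %/ g) * g by rewrite divpK // dvdp_gcdl.
have Eb : Q`_1 = (Q`_1 %/ g) * g by rewrite divpK // dvdp_gcdr.
exists (- Q`_0 %/ g), (Q`_1 %/ g); split.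
- by move: b0; rewrite {1}Eb mulf_eq0 negb_or => /andP[].
- by apply: coprimep_div_gcd; rewrite b0 orbT.
apply: cof_sub (cof_and (cof_graph vQ Qmin) (cof_nonroot b0)) => x [gx bx].
have := bx; rewrite {1}Eb hornerM mulf_eq0 negb_or => /andP[bgx gx0].
split=> //; rewrite -(gx (- (Q`_0).[x] / (Q`_1).[x])); last first.
  by rewrite evQ mulrC divfK // subrr.
rewrite -hornerN {1}Ea {1}Eb !hornerM invfM mulrACA divff // mulr1 //.
Qed.

End GenericRationality.

(** * Injective rational functions are Moebius transformations *)

Section GenericMoebius.
Variables (phi : k -> k) (S : seq k) (a b : {poly k}).
Hypothesis phi_inj : forall x y, x \notin S -> y \notin S -> phi x = phi y -> x = y.
Hypothesis ab_coprime : coprimep a b.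
Hypothesis b_neq0 : b != 0.
Hypothesis phi_ab : forall x, x \notin S -> b.[x] != 0 /\ phi x = a.[x] / b.[x].

Let not_constant c : cof (fun x => phi x = c) -> False.
Proof.
move=> H; have [x [xc xS]] := cof_meet (cof_and H (cof_notin S)).
have [y [[yc yS]]] := cof_meet (cof_and (cof_and H (cof_notin S)) (cof_notin [:: x])).
by rewrite inE => /eqP; apply; apply: phi_inj; rewrite // xc yc.
Qed.

(** If the Wronskian vanishes, coprimality makes [a] and [b] divide their own derivatives, so both
    are constant in characteristic zero. *)
Lemma wronskian_neq0 : (2 < maxn (size a) (size b))%N -> a * b^`() - a^`() * b != 0.
Proof.
move=> ab2; apply/eqP => /eqP; rewrite subr_eq0 => /eqP W.
have dvd_deriv p : p %| p^`() -> (size p <= 1)%N.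
  have [->|p0] := eqVneq p 0; first by rewrite size_poly0.
  have [/(deriv_eq0_size k_char0)//|dp0] := eqVneq p^`() 0.
  by move/(dvdp_leq dp0); rewrite leqNgt lt_size_deriv.
have a1 : (size a <= 1)%N.
  by apply: dvd_deriv; rewrite -(Gauss_dvdpl _ ab_coprime) -W dvdp_mulr.
have b1 : (size b <= 1)%N.
  apply: dvd_deriv; have ba := ab_coprime; rewrite coprimep_sym in ba.
  by rewrite -(Gauss_dvdpr _ ba) W dvdp_mull.
by move: ab2; rewrite ltnNge geq_max (leqW a1) (leqW b1).
Qed.

(** Otherwise a generic value would be taken twice, as [a - c b] has two
    distinct roots for almost all [c]. *)
Lemma injective_degree : (maxn (size a) (size b) <= 2)%N.
Proof.
rewrite leqNgt; apply/negP => ab2; set n := maxn _ _ in ab2.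
have w0 := wronskian_neq0 ab2; set w := a * _ - _ in w0.
have [rw _ Hrw] := seq_of_roots w0.
(* As a polynomial in [c], this is the coefficient of degree [n.-1] of [a - c *: b]; a generic [c]
   keeps it nonzero, so the degree does not drop. *)
have lc0 : (a`_n.-1)%:P - b`_n.-1 *: 'X != 0 :> {poly k}.
  apply: contraTneq ab2 => E.
  have H c : a`_n.-1 - b`_n.-1 * c = 0.
    by have := congr1 (horner^~ c) E;
      rewrite hornerD hornerN hornerZ hornerC hornerX horner0.
  have := H 0; rewrite mulr0 subr0 => a0; have /eqP := H 1.
  rewrite a0 mulr1 sub0r oppr_eq0 => /eqP b0; rewrite -leqNgt.
  move: a0 b0; rewrite /n; case: (leqP (size a)) => ab a0 b0.
    by move/eqP: b0; rewrite -lead_coefE lead_coef_eq0 (negbTE b_neq0).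
  move/eqP: a0; rewrite -lead_coefE lead_coef_eq0 => /eqP a0.
  by rewrite a0 size_poly0.
(* Avoiding these values keeps the roots of [a - c *: b] out of [S] and away from the zeros of the
   Wronskian. *)
pose vals := [seq a.[x] / b.[x] | x <- S ++ rw].
have [c [cv]] := cof_meet (cof_and (cof_notin vals) (cof_nonroot lc0)).
rewrite hornerD hornerN hornerZ hornerC hornerX => lc.
pose p := a - c *: b.
have pn : (n <= size p)%N.
  rewrite leqNgt; apply/negP => pn; move: lc.
  rewrite [_ * c]mulrC -coefZ -coefB -/p nth_default ?eqxx //.
  by move: pn; case: (n) ab2.
have rootP x : root p x -> [/\ a.[x] = c * b.[x], b.[x] != 0, x \notin S & w.[x] != 0].
  rewrite rootE hornerD hornerN hornerZ subr_eq0 => /eqP px.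
  have bx : b.[x] != 0.
    apply/eqP => bx; have := coprimep_root ab_coprime (x := x);
      rewrite /root px bx mulr0 !eqxx.
    by move/(_ isT).
  have : x \notin S ++ rw.
    by apply: contra cv => xS; apply/mapP; exists x => //; rewrite px mulfK.
  by rewrite mem_cat negb_or => /andP[? /negP xrw]; split=> //; apply/negP => /Hrw.
have [x [y [px py pxy]]] := two_roots (leq_trans ab2 pn).
have [[ax bx xS wx] [ay by_ yS _]] := (rootP _ px, rootP _ py).
have xy : x = y.
  apply: phi_inj => //; have [[_ ->] [_ ->]] := (phi_ab xS, phi_ab yS).
  by rewrite ax ay !mulfK.
(* At a double root the derivatives of [a] and [b] are also in the ratio [c], which makes the
   Wronskian vanish. *)
move: (pxy xy); rewrite rootE derivB derivZ hornerD hornerN hornerZ subr_eq0 => /eqP dx.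
by move: wx; rewrite hornerD hornerN !hornerM ax dx mulrAC subrr eqxx.
Qed.

(** [phi] is generically a Moebius transformation; moving the point at infinity
    to the pole makes the latter a permutation of [k]. *)
Lemma generic_bijection : exists g, bijective g /\ cof (fun x => phi x = g x).
Proof.
have := injective_degree; rewrite geq_max => /andP[sa sb].
have linE p x : (size p <= 2)%N -> p.[x] = p`_0 + p`_1 * x.
  move=> p2; rewrite (horner_coef_wide _ p2) !big_ord_recl big_ord0 /= /bump /=.
  by rewrite expr0 mulr1 expr1 addr0.
have aE x := linE a x sa; have bE x := linE b x sb.
move: (a`_0) (a`_1) (b`_0) (b`_1) aE bE => a0 a1 b0 b1 aE bE.
have phiE : cof (fun x => b0 + b1 * x != 0 /\ phi x = (a0 + a1 * x) / (b0 + b1 * x)).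
  by apply: cof_sub (cof_notin S) => x /phi_ab; rewrite aE bE.
(* A zero determinant makes the fraction constant, against the injectivity of [phi]. *)
have D0 : a1 * b0 - a0 * b1 != 0.
  apply/eqP => D0; have [b1z|b1n] := eqVneq b1 0.
    apply: (@not_constant (a0 / b0)); apply: cof_sub phiE => x [].
    rewrite b1z mul0r addr0 => b0n ->; move/eqP: D0;
      rewrite b1z mulr0 subr0 mulf_eq0 (negbTE b0n).
    by rewrite orbF => /eqP ->; rewrite mul0r addr0.
  apply: (@not_constant (a1 / b1)); apply: cof_sub phiE => x [bx ->].
  apply/eqP; rewrite eqr_div //; apply/eqP.
  by rewrite -[LHS]addr0 -D0; ring.
have [b1z|b1n] := eqVneq b1 0.
  have b0n : b0 != 0 by apply: contra_neq D0 => ->; rewrite b1z; ring.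
  have a1n : a1 != 0 by apply: contra_neq D0 => ->; rewrite b1z; ring.
  exists (fun x => (a0 + a1 * x) / b0); split.
    by exists (fun y => (b0 * y - a0) / a1) => x; field; rewrite ?b0n ?a1n.
  by apply: cof_sub phiE => x [_ ->]; rewrite b1z mul0r addr0.
pose g x := if b0 + b1 * x == 0 then a1 / b1 else (a0 + a1 * x) / (b0 + b1 * x).
pose h y := if a1 - b1 * y == 0 then - b0 / b1 else (b0 * y - a0) / (a1 - b1 * y).
exists g; split; last by apply: cof_sub phiE => x [/negbTE bx ->]; rewrite /g bx.
exists h => x.
  rewrite /g; case: eqP => [|/eqP] bx.
    rewrite /h [b1 * _]mulrC divfK // subrr eqxx; apply: (mulfI b1n).
    by rewrite [LHS]mulrC divfK //; apply/eqP; rewrite eq_sym -addr_eq0 addrC bx.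
  have E : a1 - b1 * ((a0 + a1 * x) / (b0 + b1 * x)) =
    (a1 * b0 - a0 * b1) / (b0 + b1 * x) by field.
  rewrite /h E mulf_eq0 invr_eq0 (negbTE D0) (negbTE bx) /=.
  by field; rewrite bx D0.
rewrite /h; case: eqP => [|/eqP] bx.
  rewrite /g [b1 * _]mulrC divfK // addrN eqxx; apply: (mulfI b1n).
  by rewrite [LHS]mulrC divfK //; apply/eqP; rewrite -subr_eq0 bx.
have E : b0 + b1 * ((b0 * x - a0) / (a1 - b1 * x)) =
  (a1 * b0 - a0 * b1) / (a1 - b1 * x) by field.
rewrite /g E mulf_eq0 invr_eq0 (negbTE D0) (negbTE bx) /=.
by field; rewrite bx D0.
Qed.

End GenericMoebius.

(** Let [S'] collect [s] and the points where [phi] and [g] may differ. As [g] is a permutation, it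
    maps [S'] onto the disjoint union of [t] and the [phi]-image of [S'] minus [s]: both are the
    complement of the common image of the points outside [S']. Counting and cancelling gives the
    claim. *)
Lemma cofinite_bijection_size (phi : k -> k) (s t : seq k) :
  uniq s -> uniq t ->
  (exists g, bijective g /\ cof (fun x => phi x = g x)) ->
  (forall x, x \notin s -> phi x \notin t) ->
  (forall x y, x \notin s -> y \notin s -> phi x = phi y -> x = y) ->
  (forall y, y \notin t -> exists2 x, x \notin s & phi x = y) ->
  size s = size t.
Proof.
move=> us ut [g [[h gK hK] [S phig]]] phit phi_inj phi_sur.
pose S' := undup (s ++ S); have uS' : uniq S' := undup_uniq _.
pose r := [seq x <- S' | x \notin s].
have rs x : x \in r -> x \notin s by rewrite mem_filter => /andP[].
have notS' x : x \notin S' -> x \notin s /\ phi x = g x.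
  by rewrite mem_undup mem_cat negb_or => /andP[-> /phig].
have sr : size S' = (size r + size s)%N.
  have := count_predC (fun x => x \notin s) S'; rewrite -!size_filter => <-.
  congr (_ + _)%N.
  apply: perm_size; apply: uniq_perm; rewrite ?filter_uniq // => x.
  rewrite mem_filter /= negbK; apply/andP/idP => [[]//|xs]; split=> //.
  by rewrite mem_undup mem_cat xs.
have E : size (map g S') = size (t ++ map phi r).
  apply: uniq_size_of_mem.
  - by rewrite map_inj_uniq //; apply: can_inj gK.
  - rewrite cat_uniq ut /= map_inj_in_uniq; last first.
      by move=> x y /rs xs /rs ys; apply: phi_inj.
    rewrite filter_uniq // andbT; apply/hasPn => y /mapP[x /rs xs ->].
    exact: phit.
  - move=> y; rewrite mem_cat; split=> [/mapP[x xS' ->]|].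
      apply: contraT; rewrite negb_or => /andP[/phi_sur[x' xs' gx'] nr].
      have xr' : x' \notin r by apply: contra nr => xr'; apply/mapP; exists x'.
      have xS : x' \notin S' by apply: contra xr'; rewrite mem_filter xs'.
      have [_] := notS' _ xS; rewrite gx' => /(can_inj gK) E.
      by move: xS; rewrite -E xS'.
    rewrite -[y]hK (mem_map (can_inj gK)) => /orP[] yt; apply: contraT => hS;
      have [ys E] := notS' _ hS.
      by have := phit _ ys; rewrite E yt.
    have /mapP[x xr] := yt; rewrite -E => /phi_inj Ex.
    have hx : h y = x by apply: Ex => //; apply: rs.
    by move: xr hS; rewrite -hx mem_filter => /andP[_ ->].
move: E; rewrite size_cat !size_map sr => /eqP.
by rewrite addnC eqn_add2r => /eqP.
Qed.

Lemma Def_bijection_size r (P : (nat -> k) -> Prop) (s t : seq k) :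
  Def r P -> uniq s -> uniq t ->
  let G x y := P (pair_env x y) in
  (forall x y, G x y -> x \notin s /\ y \notin t) ->
  (forall x, x \notin s -> exists! y, G x y) ->
  (forall y, y \notin t -> exists! x, G x y) -> size s = size t.
Proof.
move=> rP us ut G Gst Gx Gy; have [L HL] := Def_polys rP.
have /choice[phi Hphi] : forall x, exists y,
  x \notin s -> G x y /\ (forall z, G x z -> z = y).
  move=> x; have [_|xs] := boolP (x \in s); first by exists 0.
  by have [y [Gy' Hy]] := Gx x xs; exists y => _; split=> // z /Hy.
have Gphi x : x \notin s -> forall y, G x y <-> y = phi x.
  by move=> /Hphi[Gp Hp] y; split=> [/Hp|->].
have phi_inj x y : x \notin s -> y \notin s -> phi x = phi y -> x = y.
  move=> xs ys E; have Gxx : G x (phi x) by apply/Gphi.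
  have Gyy : G y (phi x) by apply/Gphi.
  have [_ /Gy[z [_ Hz]]] := Gst _ _ Gxx.
  by rewrite -(Hz x Gxx) -(Hz y Gyy).
apply: (@cofinite_bijection_size phi) => //.
- have [a [b [b0 ab [S Sab]]]] := generic_rational HL Gphi.
  apply: (@generic_bijection phi (s ++ S) a b) => // [x y|x]; rewrite !mem_cat !negb_or.
    by move=> /andP[? _] /andP[? _]; apply: phi_inj.
  by case/andP=> _ /Sab.
- by move=> x xs; have /Gst[] : G x (phi x) by apply/Gphi.
- move=> y /Gy[x [Gxy _]]; have [xs _] := Gst _ _ Gxy.
  by exists x => //; apply/esym/Gphi.
Qed.

End Moebius.

(** * Hume's Principle *)

Section Hume.
Variable k : closedFieldType.
Hypothesis k_char0 : [pchar k] =i pred0.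
Implicit Types (s t c : seq k) (x y : k).

Lemma definable_val n (X : definable k n) : definable k n (val X).
Proof. exact: set_mem (valP X). Qed.

Lemma Def_definable s (P : (nat -> k) -> Prop) n : Def s P ->
  definable k n [set v | P (nth 0 v)].
Proof. by case=> f _ ->; exists f => v /=; rewrite fholds_nth. Qed.

Definition define s (P : (nat -> k) -> Prop) n (sP : Def s P) : definable k n :=
  SigSub (mem_set (Def_definable n sP)).

Lemma definable_Def n (X : definable k n) : exists s P, Def s P /\
  forall v : n.-tuple k, val X v <-> P (nth 0 v).
Proof.
have [f Hf] := definable_val X; exists (fconsts f), ((@fholds k)^~ f).
split; first exact: Def_fholds (formula_over_fconsts f).
by move=> v; rewrite fholds_nth.
Qed.

Definition extension (X : definable k 1) : k -> Prop := fun x => val X [tuple x].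

Definition number (X : definable k 1) : k := xget 0 (has_number (extension X)).

Lemma extension_small_or_cosmall X : exists n, small_or_cosmall n (extension X).
Proof.
have [s [P [sP XP]]] := definable_Def X; have [n /(_ (fun=> 0)) Hn] := fiber_bound sP.
exists n; move: Hn; congr small_or_cosmall; apply/funext => x; apply/propext.
by rewrite /extension XP nth_scat.
Qed.

Lemma has_number_number X : has_number (extension X) (number X).
Proof.
have [n /has_number_ex [b Xb]] := extension_small_or_cosmall X.
exact: (@xgetPex _ 0 (has_number (extension X))) (ex_intro _ b Xb).
Qed.

Lemma number_eq X b : number X = b <-> has_number (extension X) b.
Proof.
split=> [<-|Xb]; first exact: has_number_number.
exact: (has_number_uniq k_char0 (has_number_number X) Xb).
Qed.

(** Counting settles bijections between finite sets and excludes one between a finite and a cofinite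
    set; two cofinite sets are left to [Def_bijection_size]. *)
Lemma finite_image (Y : k -> Prop) (G : k -> k -> Prop) s : uniq s ->
  (forall x y, G x y -> x \in s /\ Y y) ->
  (forall x, x \in s -> exists! y, G x y) ->
  (forall y, Y y -> exists! x, G x y) ->
  exists2 t, uniq t /\ size t = size s & forall y, Y y <-> y \in t.
Proof.
move=> us GsY Gx Gy.
have /choice[phi Hphi] : forall x, exists y,
  x \in s -> G x y /\ (forall z, G x z -> z = y).
  move=> x; have [xs|_] := boolP (x \in s); last by exists 0.
  by have [y [Gy' Hy]] := Gx x xs; exists y => _; split=> // z /Hy.
exists (map phi s); rewrite ?size_map.
  rewrite map_inj_in_uniq // => x y /Hphi[Gxx _] /Hphi[Gyy _] E; rewrite -E in Gyy.
  by have [_ /Gy[z [_ Hz]]] := GsY _ _ Gxx; rewrite -(Hz x Gxx) -(Hz y Gyy).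
move=> y; split=> [/Gy[x [Gxy _]]|/mapP[x /Hphi[/GsY[_ ? _]] ->]//].
have [xs _] := GsY _ _ Gxy; apply/mapP; exists x => //.
by have [_ /(_ _ Gxy)] := Hphi x xs.
Qed.

Lemma number_of_bijection (X Y : definable k 1) (F : definable k 2) :
  @bijection_graph (definable_structure number) X Y F -> number X = number Y.
Proof.
case=> FXY FX FY; pose G x y := val F [tuple x; y].
have [[nX /finite_or_cofinite[s us Xs]] [nY /finite_or_cofinite[t ut Yt]]] :=
  (extension_small_or_cosmall X, extension_small_or_cosmall Y).
have GXY x y : G x y -> extension X x /\ extension Y y by move/FXY.
case: Xs Yt => [] Xs [] Yt.
- have [t' [ut' tt'] Yt'] := @finite_image _ G s us
    (fun x y Gxy => conj (proj1 (Xs x) (GXY _ _ Gxy).1) (GXY _ _ Gxy).2)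
    (fun x xs => FX x (proj2 (Xs x) xs)) FY.
  transitivity ((size s)%:R : k); last apply: esym; apply/number_eq.
    by exists s => //; left.
  by exists t' => //; left; rewrite tt'.
- have [t' _ Yt'] := @finite_image _ G s us
    (fun x y Gxy => conj (proj1 (Xs x) (GXY _ _ Gxy).1) (GXY _ _ Gxy).2)
    (fun x xs => FX x (proj2 (Xs x) xs)) FY.
  by case: (@not_finite_cofinite _ k_char0 t' t) => y; rewrite -Yt Yt'.
- have [s' _ Xs'] := @finite_image _ (fun y x => G x y) t ut
    (fun y x Gxy => conj (proj1 (Yt y) (GXY _ _ Gxy).2) (GXY _ _ Gxy).1)
    (fun y yt => FY y (proj2 (Yt y) yt)) FX.
  by case: (@not_finite_cofinite _ k_char0 s' s) => y; rewrite -Xs Xs'.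
- have [r [P [rP FP]]] := definable_Def F.
  have GP x y : G x y = P (pair_env x y) by apply/propext; rewrite /G FP nth_scat.
  have st : size s = size t.
    apply: (Def_bijection_size k_char0 rP us ut) => [x y|x|y].
    - by rewrite -GP => /GXY[/Xs ? /Yt].
    - move=> /Xs/FX; have -> // : (fun y => P (pair_env x y)) = G x by apply/funext => y.
    - move=> /Yt/FY; have -> // : (fun x => P (pair_env x y)) = G^~ y by apply/funext =>
        x.
  transitivity (- (size s).+1%:R : k); last apply: esym; apply/number_eq.
    by exists s => //; right.
  by exists t => //; right; rewrite st.
Qed.

Lemma Def_mem s : Def s (fun e => e 0%N \in s).
Proof.
have sP : Def s (fun e => exists2 i, (i < size s)%N & e 0%N = nth 0 s i).
  apply: Def_exists => i ir;
    apply: (@Def_eq _ _ (GRing.Var k 0) (GRing.Const (nth 0 s i))) => //=.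
  by rewrite mem_nth.
apply: Def_ext sP => e; split=> [[i ir ->]|es]; first exact: mem_nth.
by exists (index (e 0%N) s); rewrite ?index_mem ?nth_index.
Qed.

(** The bijection is the identity on [Z] and matches the lists by position, their entries being
    parameters. Finite sets use it with empty [Z], cofinite ones with their intersection as [Z]. *)
Lemma list_bijection (Z : k -> Prop) s t r : uniq s -> uniq t -> size s = size t ->
  (forall x, Z x -> x \notin s /\ x \notin t) -> Def r (fun e => Z (e 0)) ->
  exists F : definable k 2,
  [/\ forall x y, val F [tuple x; y] -> (Z x \/ x \in s) /\ (Z y \/ y \in t),
      forall x, Z x \/ x \in s -> exists! y, val F [tuple x; y]
    & forall y, Z y \/ y \in t -> exists! x, val F [tuple x; y]].
Proof.
move=> us ut st Zst rZ.
pose P (e : nat -> k) := (Z (e 0) /\ e 1 = e 0) \/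
  exists2 i, (i < size s)%N & e 0 = nth 0 s i /\ e 1 = nth 0 t i.
have rP : Def (r ++ s ++ t) P.
  apply: Def_or; first apply: Def_and; last apply: Def_exists => i ist.
  - by apply: Def_mono rZ => x xr; rewrite mem_cat xr.
  - exact: Def_eqv.
  - apply: Def_and; last have it : (i < size t)%N by rewrite -st.
      apply: (@Def_eq _ _ (GRing.Var k 0) (GRing.Const (nth 0 s i))) => //=.
      by rewrite !mem_cat mem_nth ?orbT.
    apply: (@Def_eq _ _ (GRing.Var k 1) (GRing.Const (nth 0 t i))) => //=.
    by rewrite !mem_cat mem_nth ?orbT.
exists (define 2 rP).
have FE x y : val (define 2 rP) [tuple x; y] = ((Z x /\ y = x) \/
  exists2 i, (i < size s)%N & x = nth 0 s i /\ y = nth 0 t i) by [].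
split=> [x y|x|y].
- rewrite FE => -[[Zx ->]|[i ist [-> ->]]]; first by split; left.
  by split; right; rewrite mem_nth // -st.
- case=> [Zx|xs].
    exists x; split=> [|y]; rewrite FE; first by left.
    case=> [[]//|[i ist [Ex _]]].
    by have [/negP[]] := Zst x Zx; rewrite Ex mem_nth.
  have ist : (index x s < size s)%N by rewrite index_mem.
  exists (nth 0 t (index x s)); split=> [|y]; rewrite FE.
    by right; exists (index x s); rewrite ?nth_index.
  case=> [[/Zst[/negP//]]|[i' ist' [-> ->]]].
  by rewrite index_uniq.
- case=> [Zy|yt].
    exists y; split=> [|x]; rewrite FE; first by left.
    case=> [[_ ->]//|[i ist [_ Ey]]].
    by have [_ /negP[]] := Zst y Zy; rewrite Ey mem_nth // -st.
  have ist : (index y t < size t)%N by rewrite index_mem.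
  exists (nth 0 s (index y t)); split=> [|x]; rewrite FE.
    by right; exists (index y t); rewrite ?nth_index ?st.
  case=> [[Zx yx]|[i' ist' [-> ->]]]; last by rewrite index_uniq // -st.
  by have [_ /negP[]] := Zst x Zx; rewrite -yx.
Qed.

Lemma bijection_of_number (X Y : definable k 1) : number X = number Y ->
  exists F : definable k 2, @bijection_graph (definable_structure number) X Y F.
Proof.
move=> XY; have [s us Xs] := has_number_number X.
have [t ut Yt] := has_number_number Y; rewrite -XY in Yt.
have no_sum m n : (m%:R : k) = - n.+1%:R -> False.
  by move/eqP; rewrite -addr_eq0 -natrD addnS => /eqP/(natr_inj k_char0 (x2 := 0%N)).
case: Xs Yt => -[Xs nX] [] [Yt]; rewrite nX.
- move/(natr_inj k_char0) => st.
  have FF x : False -> x \notin s /\ x \notin t by [].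
  have [F [F1 F2 F3]] := list_bijection us ut st FF (Def_prop [::] False).
  exists F; split=> [x y /F1[[]// xs []// yt]|x Xx|y Yy].
  + by split; [apply/Xs|apply/Yt].
  + by apply: F2; right; apply/Xs.
  + by apply: F3; right; apply/Yt.
- by move/no_sum.
- by move/esym/no_sum.
move/oppr_inj/(natr_inj k_char0) => -[st].
(* The two cofinite sets are [Z] plus [u] and [Z] plus [v]; the lengths of [u] and [v] agree because
   those of [s] and [t] do. *)
pose u := [seq x <- t | x \notin s]; pose v := [seq x <- s | x \notin t].
have uv : size u = size v.
  have := count_predC (fun x => x \in s) t; have := count_predC (fun x => x \in t) s.
  rewrite -st => <-; rewrite -!size_filter /=.
  have -> : size [seq x <- t | x \in s] = size [seq x <- s | x \in t].
    by apply: uniq_size_of_mem; rewrite ?filter_uniq // => x; rewrite !mem_filter andbC.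
  by move/addnI.
pose Z x := x \notin s /\ x \notin t.
have rZ : Def (s ++ t) (fun e => Z (e 0)).
  have rin (r r' : seq k) :
    {subset r <= r'} -> Def r' (fun e : nat -> k => e 0%N \notin r).
    move=> rr'; apply: Def_ext (Def_not (Def_mono rr' (Def_mem r))) => e.
    by split=> /negP.
  by apply: Def_and; apply: rin => x xs; rewrite mem_cat xs ?orbT.
have ZuE x : (Z x \/ x \in u) <-> x \notin s.
  rewrite /Z mem_filter; split=> [[[]//|/andP[]//]|xs].
  by have [xt|xt] := boolP (x \in t); [right; rewrite xs|left].
have ZvE x : (Z x \/ x \in v) <-> x \notin t.
  rewrite /Z mem_filter; split=> [[[]//|/andP[]//]|xs].
  by have [xt|xt] := boolP (x \in s); [right; rewrite xs|left].
have Zuv x : Z x -> x \notin u /\ x \notin v.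
  by move=> [xs xt]; rewrite !mem_filter !negb_and xs xt !orbT.
have [F [F1 F2 F3]] :=
  list_bijection (filter_uniq _ ut) (filter_uniq _ us) uv Zuv rZ.
exists F; split=> [x y /F1[/ZuE xs /ZvE yt]|x Xx|y Yy].
- by split; [apply/Xs|apply/Yt].
- by apply: F2; apply/ZuE/Xs.
- by apply: F3; apply/ZvE/Yt.
Qed.

Lemma number_Hume : HumePrinciple (definable_structure number).
Proof.
move=> X Y; split; first exact: bijection_of_number.
by case=> F; apply: number_of_bijection.
Qed.

End Hume.

(** * Saturation for tuples *)

Section Saturation.
Variable k : closedFieldType.
Hypothesis k_char0 : [pchar k] =i pred0.
Hypothesis k_sat : saturated k.
Implicit Types (s c v : seq k) (x y : k) (F : set ((nat -> k) -> Prop)).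

(** Directedness reduces finite satisfiability to that of single members. *)
Definition directed F :=
  forall P Q, F P -> F Q -> exists2 R, F R & forall e, R e -> P e /\ Q e.

Lemma seq_not_ge_card s : ~~ ([set: k] #<= [set` s])%card.
Proof.
apply/negP => /card_le_finite/(_ (finite_seq s))/finite_seqP[s' E].
by have [x] := fresh k_char0 s'; have : [set: k] x by []; rewrite E /= => ->.
Qed.

Lemma saturated_directed s F : F !=set0 -> directed F -> (forall P, F P -> Def s P) ->
  (forall P, F P -> exists x, P (nth 0 [:: x])) ->
  exists x, forall P, F P -> P (nth 0 [:: x]).
Proof.
move=> [P0 FP0] dF sF satF.
pose p := [set f | formula_over [set` s] f /\ F (fun e => fholds e f)].
have [||x Hx] := k_sat (seq_not_ge_card s) (p := p).
- by move=> f [].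
- move=> q fq qp; have [l ql] := (finite_seqP (T := {classic (GRing.formula k)}) q).1 fq.
  have [P FP HP] : exists2 P, F P & forall f, q f -> forall e, P e -> fholds e f.
    have {qp} : forall f, f \in l -> p f by move=> f fl; apply: qp; rewrite ql.
    rewrite {}ql {fq}; elim: l => [|f l IHl] lp; first by exists P0.
    have [f' f'l|P FP HP] := IHl; first by apply: lp; rewrite inE f'l orbT.
    have [_ Ff] := lp f (mem_head _ _); have [R FR HR] := dF _ _ FP Ff.
    exists R => // f' /=; rewrite inE => /predU1P[-> e /HR[]//|f'l e /HR[Pe _]].
    exact: HP f'l e Pe.
  have [x Px] := satF P FP; exists x => f qf.
  by rewrite -fholds_nth; apply: HP.
- exists x => P FP; have [f sf Pf] := sF P FP.
  by rewrite Pf fholds_nth; apply: Hx; split=> //; rewrite -Pf.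
Qed.

Lemma Def_tuple s (P : (nat -> k) -> Prop) n : Def s P ->
  Def s (fun e => exists2 v, size v = n & P (scons (e 0) (nth 0 v))).
Proof.
move=> sP.
(* The block [v] occupies the variables below [n], whence the variable [n] for [e 0]; the constant 0
   imitates the default of [nth]. *)
pose g j := if j is j'.+1 then if (j' < n)%N then GRing.Var k j' else GRing.NatConst k 0
            else GRing.Var k n.
have sg j : term_over [set` s] (g j) by case: j => [|j] //=; case: ifP.
apply: Def_ext (Def_exn n (Def_subs sg sP)) => e.
have E v : size v = n -> (fun j => feval (scat v e) (g j)) = scons (e 0) (nth 0 v).
  move=> vn; apply/funext => -[|j] /=.
    by rewrite -[in RHS](shift_scat e vn) /shift addn0.
  case: ltnP => jn /=; last by rewrite nth_default ?vn.
  by rewrite scat_lt ?vn.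
by split=> -[v vn]; rewrite ?E // => Pv; exists v; rewrite ?E.
Qed.

(** Saturation fills one variable at a time. The projections to the first coordinate are again
    directed and definable over [s]; a value [x] lying in all of them joins the parameters for the
    remaining coordinates. *)
Lemma saturated_tuples n s F : F !=set0 -> directed F -> (forall P, F P -> Def s P) ->
  (forall P, F P -> exists2 v, size v = n & P (nth 0 v)) ->
  exists2 v, size v = n & forall P, F P -> P (nth 0 v).
Proof.
elim: n s F => [|n IHn] s F [P0 FP0] dF sF satF.
  by exists [::] => // P /satF[[|//]].
have nthS x v : nth 0 (x :: v) = scons x (nth 0 v) by apply/funext => -[].
pose proj (P : (nat -> k) -> Prop) (e : nat -> k) := exists2 v,
  size v = n & P (scons (e 0) (nth 0 v)).
have [||||x Hx] := @saturated_directed s [set proj P | P in F].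
- by exists (proj P0), P0.
- move=> _ _ [P FP <-] [Q FQ <-]; have [R FR HR] := dF _ _ FP FQ.
  by exists (proj R); [exists R|move=> e [v vn /HR[? ?]]; split; exists v].
- by move=> _ [P FP <-]; apply: Def_tuple; apply: sF.
- move=> _ [P FP <-]; have [[|x v] // [vn]] := satF P FP.
  by rewrite nthS; exists x, v.
have [||||v vn Hv] := IHn (x :: s) [set (fun e : nat -> k => P (scons x e)) | P in F].
- by exists (fun e => P0 (scons x e)), P0.
- move=> _ _ [P FP <-] [Q FQ <-]; have [R FR HR] := dF _ _ FP FQ.
  by exists (fun e => R (scons x e)); [exists R|move=> e /HR].
- move=> _ [P FP <-].
  pose g j := if j is j'.+1 then GRing.Var k j' else GRing.Const x.
  have sg j : term_over [set` x :: s] (g j) by case: j => //=; rewrite mem_head.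
  have sP : Def (x :: s) P by apply: Def_mono (sF P FP) => y ys; rewrite inE ys orbT.
  apply: Def_ext (Def_subs sg sP) => e.
  by have -> : (fun j => feval e (g j)) = scons x e by apply/funext => -[].
- move=> _ [P FP <-]; have [|v vn Pv] := Hx (proj P); first by exists P.
  by exists v.
exists (x :: v) => [|P FP]; first by rewrite /= vn.
by rewrite nthS; apply: (Hv (fun e => P (scons x e))); exists P.
Qed.

End Saturation.

(** * Second-order formulas *)

Definition otbound (t : oterm) : nat := match t with OVar i | OAbs i => i.+1 end.

(** Arities are bounded along with variables, so that only finitely many relations contribute
    parameters. *)
Fixpoint obound (f : Defs.form) : nat :=
  match f with
  | FEq s t => maxn (otbound s) (otbound t)
  | FEqR n i j => maxn n.+1 (maxn i.+1 j.+1)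
  | FIn n ts i => maxn (maxn n.+1 i.+1) (\max_(j < n.+1) otbound (tnth ts j))
  | FNot f => obound f
  | FAnd f g | FOr f g | FImp f g => maxn (obound f) (obound g)
  | FEx _ f | FAll _ f | FExR _ _ f | FAllR _ _ f => obound f
  end.

Section Translation.
Variable k : closedFieldType.
Hypothesis k_char0 : [pchar k] =i pred0.
Implicit Types (s c v : seq k) (x y : k).

Local Notation M := (definable_structure (@number k)).
Local Notation env := (nat -> k).

(** In the defining environment, the entries of the object or relation precede
    the environment on which it depends. *)
Definition DefO s (a : env -> k) := Def s (fun e => a (shift 1 e) = e 0).

Definition DefR s n (X : env -> definable k n) :=
  Def s (fun e => val (X (shift n e)) [tuple e j | j < n]).

Lemma DefO_shift s a m : DefO s a -> DefO s (fun e => a (shift m e)).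
Proof. exact: (@Def_comp _ _ _ (fun j => if j is j'.+1 then (1 + (m + j'))%N else 0%N)).
  Qed.

Lemma mktuple_scat n (v : n.-tuple k) e : [tuple scat v e j | j < n] = v.
Proof. by apply: eq_from_tnth => j;
  rewrite tnth_mktuple scat_lt ?size_tuple // -tnth_nth. Qed.

Lemma DefR_shift s n (X : env -> definable k n) m :
  DefR s X -> DefR s (fun e => X (shift m e)).
Proof.
move=> sX; pose r j := if (j < n)%N then j else (n + (m + (j - n)))%N.
apply: Def_ext (Def_comp r sX) => e.
have -> : shift n (fun j => e (r j)) = shift m (shift n e).
  by apply/funext => j; rewrite /shift /r ltnNge leq_addr /= addKn.
have -> // : [tuple e (r j) | j < n] = [tuple e j | j < n].
by apply: eq_from_tnth => j; rewrite !tnth_mktuple /r ltn_ord.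
Qed.

(** As the relation varies with [e], this rests on the number being a first-order function of the
    parameters. *)
Lemma DefO_number s (X : env -> definable k 1) :
  DefR s X -> DefO s (fun e => number (X e)).
Proof.
move=> sX; apply: Def_ext (Def_has_number k_char0 sX) => e; rewrite number_eq //.
have -> // : (fun x => val (X (shift 1 (scons x (shift 1 e))))
    [tuple scons x (shift 1 e) j | j < 1]) = extension (X (shift 1 e)).
apply/funext => x; congr (val _ _).
by apply: eq_from_tnth => j; rewrite !tnth_mktuple !ord1.
Qed.

(** The second-order environment varies with [e]: an object quantifier adds a variable to [e], a
    relation quantifier the parameters of a defining formula. *)
Definition def_env s B (a : env -> nat -> k) (E : env -> renv M) : Prop :=
  (forall i, (i < B)%N -> DefO s (fun e => a e i)) /\
  (forall n i, (n < B)%N -> (i < B)%N -> DefR s (fun e => E e n i : definable k n.+1)).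

Lemma def_env_le s B B' a E : (B <= B')%N -> def_env s B' a E -> def_env s B a E.
Proof.
move=> BB' [sa sE]; split=> [i iB|n i nB iB]; first exact: sa (leq_trans iB BB').
by apply: sE; [apply: leq_trans BB'|apply: leq_trans BB'].
Qed.

Lemma def_env_upd s B a E i : def_env s B a E ->
  def_env s B (fun e => upd_obj (M := M) (a (shift 1 e)) i (e 0))
    (fun e => E (shift 1 e)).
Proof.
case=> sa sE; split=> [j jB|n j nB jB]; last exact: DefR_shift (sE n j nB jB).
rewrite /upd_obj; have [_|_] := eqVneq j i; first exact: Def_eqv.
exact: DefO_shift (sa j jB).
Qed.

Lemma DefO_oval s B a E t : def_env s B a E -> (otbound t <= B)%N ->
  DefO s (fun e => oval (M := M) (a e) (E e) t).
Proof.
case=> sa sE; case: t => i /= iB; first exact: sa.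
by apply: DefO_number; apply: sE => //; apply: leq_trans iB.
Qed.

Lemma eq_DefR s n (X Y : env -> definable k n) :
  (forall e, X e = Y e) -> DefR s Y -> DefR s X.
Proof. by move=> /funext ->. Qed.

Lemma upd_rel_same (N : structure) (E : renv N) n i (X : srel N n) j :
  upd_rel E i X n j = if j == i then X else E n j.
Proof. by rewrite /upd_rel dfwith_in. Qed.

Lemma upd_rel_other (N : structure) (E : renv N) n n' i (X : srel N n) j :
  n != n' -> upd_rel E i X n' j = E n' j.
Proof. by move=> nn'; rewrite /upd_rel dfwith_out. Qed.

Lemma mkseq_scat c e : mkseq (scat c e) (size c) = c.
Proof.
apply: (@eq_from_nth _ 0); rewrite size_mkseq // => i ic.
by rewrite nth_mkseq // scat_lt.
Qed.

Lemma srel_eq n (X Y : definable k n) : X = Y <-> forall v :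
  n.-tuple k, val X v <-> val Y v.
Proof.
split=> [->//|XY]; apply: val_inj; apply/funext => v; exact/propext.
Qed.

(** Only atoms need work. Equality of relations becomes agreement on all tuples, operator terms
    denote definable functions, and for membership the values of the terms are quantified as an
    auxiliary tuple. *)
Lemma Def_arithmetical f s a E : arithmetical f -> def_env s (obound f) a E ->
  Def s (fun e => sat (M := M) (a e) (E e) f).
Proof.
elim: f s a E => /= [t u|n i j|n ts i|f IHf|f IHf g IHg|f IHf g IHg|f IHf g IHg|i f IHf|i
  f IHf|n i f IHf|n i f IHf] s a E //.
- move=> _ sE.
  have st := DefO_oval sE (leq_maxl _ (otbound u)).
  have su := DefO_oval sE (leq_maxr (otbound t) _).
  apply: Def_ext (Def_ex (Def_and st su)) => e.
  by split=> [[x [-> ->]]//|tu]; exists (oval (M := M) (a e) (E e) u); split.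
- move=> _ [_ sE].
  have si := sE n i (leq_maxl _ _) (leq_trans (leq_maxl _ _) (leq_maxr _ _)).
  have sj := sE n j (leq_maxl _ _) (leq_trans (leq_maxr _ _) (leq_maxr _ _)).
  apply: Def_ext (Def_alln n.+1 (Def_iff si sj)) => e; rewrite srel_eq.
  split=> [H v|H v vn].
    by have := H v (size_tuple v); rewrite mktuple_scat shift_scat ?size_tuple.
  by rewrite shift_scat // -(mktuple_scat (in_tuple v)) H.
- move=> _ sE.
  have si := sE.2 n i (leq_trans (leq_maxl _ _) (leq_maxl _ _))
                      (leq_trans (leq_maxr _ _) (leq_maxl _ _)).
  pose P (e : env) := (forall j, (j < n.+1)%N ->
      oval (M := M) (a (shift n.+1 e)) (E (shift n.+1 e)) (nth (OVar 0) ts j) = e j) /\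
    val (E (shift n.+1 e) n i : definable k n.+1) [tuple e j | j < n.+1].
  have sP : Def s P.
    apply: Def_and si; apply: Def_forall => j jn.
    have tB : (otbound (nth (OVar 0) ts j) <= obound (FIn ts i))%N.
      apply: leq_trans (leq_maxr _ _).
      rewrite -[j]/(val (Ordinal jn)) -tnth_nth.
      exact: (leq_bigmax (Ordinal jn)).
    exact: (Def_comp (fun l => if l is l'.+1 then (n.+1 + l')%N else j) (DefO_oval sE
      tB)).
  apply: Def_ext (Def_exn n.+1 sP) => e.
  pose w := map_tuple (oval (M := M) (a e) (E e)) ts.
  have wE j : (j < n.+1)%N -> nth 0 w j = oval (M := M) (a e) (E e) (nth (OVar 0) ts j).
    by move=> jn; rewrite (nth_map (OVar 0)) ?size_tuple.
  split=> [[c cn [Hc]]|Hw].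
    rewrite shift_scat // in Hc *.
    have -> // : [tuple scat c e j | j < n.+1] = w.
    apply: eq_from_tnth => j; rewrite tnth_mktuple -Hc ?ltn_ord //.
    by rewrite (tnth_nth 0) wE ?ltn_ord.
  exists w; first exact: size_tuple.
  split; last by rewrite mktuple_scat shift_scat ?size_tuple.
  by move=> j jn; rewrite shift_scat ?size_tuple // scat_lt ?size_tuple // wE.
- by move=> af sE; apply: Def_not; apply: IHf.
- case/andP=> af ag sE; apply: Def_and; [apply: IHf|apply: IHg] => //;
    apply: def_env_le sE.
    exact: leq_maxl.
  exact: leq_maxr.
- case/andP=> af ag sE; apply: Def_or; [apply: IHf|apply: IHg] => //;
    apply: def_env_le sE.
    exact: leq_maxl.
  exact: leq_maxr.
- case/andP=> af ag sE; apply: Def_imp; [apply: IHf|apply: IHg] => //;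
    apply: def_env_le sE.
    exact: leq_maxl.
  exact: leq_maxr.
- by move=> af /(def_env_upd i)/(IHf _ _ _ af)/Def_ex.
- by move=> af /(def_env_upd i)/(IHf _ _ _ af)/Def_all.
Qed.

Lemma Def_fholds_scat c (th : GRing.formula k) : formula_over set0 th ->
  Def c (fun e => fholds (scat c e) th).
Proof.
move=> th0; pose g j := if (j < size c)%N then GRing.Const (nth 0 c j)
                        else GRing.Var k (j - size c).
have sg j : term_over [set` c] (g j) by rewrite /g; case: ifP => //= /(mem_nth 0).
have sth : Def c (fun e => fholds e th).
  by apply: Def_fholds; apply: formula_over_sub th0.
apply: Def_ext (Def_subs sg sth) => e.
have -> // : (fun j => feval e (g j)) = scat c e.
apply/funext => j; rewrite /g; case: ltnP => jc; first by rewrite scat_lt.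
by rewrite -[in RHS](subnKC jc) -/(shift (size c) (scat c e) _) shift_scat.
Qed.

(** Separating a constant-free formula from its parameters [c] lets the latter be quantified like
    objects. *)
Definition instance n (th : GRing.formula k) (th0 : formula_over set0 th) c :
  definable k n :=
  define n (Def_fholds_scat c th0).

Lemma instance_ex n (X : definable k n) :
  exists th (th0 : formula_over set0 th) c, X = instance n th0 c.
Proof.
have [f Hf] := definable_val X.
exists (fgen (fconsts f) f), (formula_over_fgen _ _), (fconsts f).
by apply/srel_eq => v; rewrite Hf /= fholds_fgen ?fholds_nth //;
  apply: formula_over_fconsts.
Qed.

Lemma DefR_instance s n (th : GRing.formula k) (th0 : formula_over set0 th) m :
  DefR s (fun e => instance n th0 (mkseq e m)).
Proof.
(* [DefR] puts the entries of the relation before the parameters, [instance] the parameters first;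
   the last case is the default of [nth]. *)
pose g j := if (j < m)%N then GRing.Var k (n + j) else
  if (j - m < n)%N then GRing.Var k (j - m) else GRing.NatConst k 0.
have sg j : term_over [set` s] (g j) by rewrite /g; case: ifP => //; case: ifP.
have sth : Def s (fun e => fholds e th).
  by apply: Def_fholds; apply: formula_over_sub th0.
apply: Def_ext (Def_subs sg sth) => e /=.
have -> // : (fun j => feval e (g j)) =
  scat (mkseq (shift n e) m) (nth 0 [tuple e j | j < n]).
apply/funext => j; rewrite /g; have [jm|mj] := ltnP j m.
  by rewrite scat_lt ?size_mkseq // nth_mkseq.
set E := scat _ _; rewrite -[in RHS](subnKC mj) -/(shift m E _) shift_scat ?size_mkseq //.
case: ltnP => jn; last by rewrite nth_default // size_tuple.
by rewrite -[(j - m)%N]/(val (Ordinal jn)) -tnth_nth tnth_mktuple.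
Qed.

(** The relations quantified by a [Sigma11] formula are instances of countably
    many parameter-free formulas, so such a formula is a union of predicates
    definable over the same finitely many parameters. *)
Lemma Sigma11_locally_definable f s a E : Sigma11 f -> def_env s (obound f) a E ->
  forall e, sat (M := M) (a e) (E e) f ->
  exists P : env -> Prop, [/\ Def s P, P e & forall e', P e' -> sat (M := M) (a e') (E
    e') f].
Proof.
have arith g a1 E1 : arithmetical g -> def_env s (obound g) a1 E1 ->
    forall e, sat (M := M) (a1 e) (E1 e) g ->
    exists P : env -> Prop, [/\ Def s P, P e & forall e', P e' -> sat (M := M) (a1 e')
      (E1 e') g].
  move=> ag sE e Hg; exists (fun e => sat (M := M) (a1 e) (E1 e) g); split=> //.
  exact: Def_arithmetical.
elim: f a E => [t u|n i j|n ts i|f IHf|f IHf g IHg|f IHf g IHg|f IHf g IHg|i f IHf|i f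
  IHf|n i f IHf|n i f IHf] a E;
  try exact: arith.
move=> /= Sf sE e [X HX].
have [th [th0 [c EX]]] := @instance_ex n.+1 X; set m := size c.
have [||P [sP Pe HP]] := IHf (fun e => a (shift m e))
  (fun e => upd_rel (M := M) (E (shift m e)) i (instance n.+1 th0 (mkseq e m))) Sf _
    (scat c e).
- split=> [j jB|n' j nB jB]; first exact: DefO_shift (sE.1 j jB).
  have [En|nn'] := eqVneq n n'.
    subst n'; apply: (@eq_DefR s n.+1 _ (fun e => if j == i then instance n.+1 th0 (mkseq
      e m)
      else E (shift m e) n j)) => [e1|]; first exact: (@upd_rel_same M).
    case: (j == i); first exact: DefR_instance.
    exact: DefR_shift (sE.2 n j nB jB).
  apply: (@eq_DefR s n'.+1 _ (fun e => E (shift m e) n' j)) => [e1|].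
    exact: (@upd_rel_other M).
  exact: DefR_shift (sE.2 n' j nB jB).
- by rewrite shift_scat // mkseq_scat -EX.
exists (fun e => exists2 c, size c = m & P (scat c e)); split; first exact: Def_exn.
  by exists c.
move=> e' [c' c'm /HP]; rewrite shift_scat // -c'm mkseq_scat => H.
by exists (instance n.+1 th0 c').
Qed.

(** * Comprehension from saturation *)

Fixpoint dual (f : Defs.form) : Defs.form :=
  if f is FAllR n i g then FExR n i (dual g) else FNot f.

Lemma sat_dual (N : structure) (a : nat -> dom N) (E : renv N) f :
  sat a E (dual f) <-> ~ sat a E f.
Proof.
elim: f a E => //= n i f IHf a E; split=> [[X /IHf nf] /(_ X)//|].
by move=> /existsNP[X nf]; exists X; apply/IHf.
Qed.

Lemma Sigma11_dual f : Pi11 f -> Sigma11 (dual f).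
Proof. by elim: f. Qed.

Lemma obound_dual f : obound (dual f) = obound f.
Proof. by elim: f. Qed.

(** Below [B] there are finitely many objects and relations, so their constants fit into one
    list. *)
Lemma def_env_upd_seq B n (a : env) (E : renv M) : exists s, def_env s B
  (fun e i => if (i <= n)%N then e i else a i) (fun=> E).
Proof.
have /choice[c Hc] : forall p :
  nat * nat, exists s, DefR s (fun=> E p.1 p.2 : definable k p.1.+1).
  case=> n' i /=; have [s [P [sP EP]]] := @definable_Def k n'.+1 (E n' i).
  pose g j := if (j < n'.+1)%N then GRing.Var k j else GRing.NatConst k 0.
  have sg j : term_over [set` s] (g j) by rewrite /g; case: ifP.
  exists s; apply: Def_ext (Def_subs sg sP) => e; rewrite EP.
  have -> // : (fun j => feval e (g j)) = nth 0 [tuple e j | j < n'.+1].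
  apply/funext => j; rewrite /g; case: ltnP => jn;
    last by rewrite nth_default // size_tuple.
  by rewrite -[j]/(val (Ordinal jn)) -tnth_nth tnth_mktuple.
pose s := flatten [seq c (n', i) | n' <- iota 0 B, i <- iota 0 B] ++ mkseq a B.
exists s; split=> [i iB|n' i nB iB].
  rewrite /DefO; case: (i <= n)%N; first exact: (@Def_eqv _ s i.+1 0).
  apply: (@Def_eq _ _ (GRing.Const (a i)) (GRing.Var k 0)) => //=.
  by rewrite mem_cat; apply/orP; right; apply/mapP; exists i; rewrite // mem_iota.
apply: Def_mono (Hc (n', i)) => x xc; rewrite mem_cat; apply/orP; left.
apply/flattenP; exists (c (n', i)) => //.
by apply/allpairsP; exists (n', i); rewrite /= !mem_iota.
Qed.

Hypothesis k_sat : saturated k.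

Lemma number_Delta11 : Delta11_comprehension M.
Proof.
move=> n f g a E Sf Pg fg.
have [s sE] := def_env_upd_seq (maxn (obound f) (obound g)) n a E.
set ae := fun e i => _ in sE.
have aeE (v : n.+1.-tuple k) : ae (nth 0 v) = upd_seq (M := M) a v.
  apply/funext => i; rewrite /ae /upd_seq; case: leqP => iv; last first.
    by rewrite nth_default // size_tuple.
  by apply: set_nth_default; rewrite size_tuple.
pose implies P h := forall e : env, P e -> sat (M := M) (ae e) E h.
(* A member of [F] is what one definable piece of [f] and one of [dual g] leave uncovered; unions of
   pieces are pieces, so [F] is directed. *)
pose F : set (env -> Prop) := [set R | exists P Q, [/\ Def s P, Def s Q, implies P f,
  implies Q (dual g) & R = fun e => ~ P e /\ ~ Q e]].
have nP : Def s (fun=> False) by apply: Def_prop.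
apply: contrapT => noR.
have [||||v vn Hv] := @saturated_tuples k k_char0 k_sat n.+1 s F.
- by exists (fun e => ~ False /\ ~ False), (fun=> False), (fun=> False); split.
- move=> _ _ [P [Q [sP sQ Pf Qg ->]]] [P' [Q' [sP' sQ' Pf' Qg' ->]]].
  exists (fun e => ~ (P e \/ P' e) /\ ~ (Q e \/ Q' e)); last by move=> e; tauto.
  exists (fun e => P e \/ P' e), (fun e => Q e \/ Q' e); split=> //; try exact: Def_or.
    by move=> e [/Pf|/Pf'].
  by move=> e [/Qg|/Qg'].
- by move=> _ [P [Q [sP sQ _ _ ->]]]; apply: Def_and; apply: Def_not.
(* Were nothing left uncovered, [P] would be exactly the relation defined by [f]. *)
- move=> _ [P [Q [sP sQ Pf Qg ->]]]; apply: contrapT => noV; apply: noR.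
  exists (define n.+1 sP) => v /=; rewrite -aeE; split=> [/Pf//|fv].
  apply: contrapT => nPv; apply: noV; exists v; first exact: size_tuple.
  split=> // /Qg; rewrite sat_dual; apply.
  by move: fv; rewrite aeE => /fg.
(* The tuple [v] escapes all pieces, yet it satisfies [f] or [dual g] and so lies in one. *)
- have /eqP vn' := vn; pose w := Tuple vn'.
  have EF h : Sigma11 h -> (obound h <= maxn (obound f) (obound g))%N ->
      sat (M := M) (ae (nth 0 v)) E h ->
      exists P, [/\ Def s P, P (nth 0 v) & implies P h].
    move=> Sh hB; exact: (Sigma11_locally_definable Sh (def_env_le hB sE)).
  have [fv|nfv] := pselect (sat (M := M) (ae (nth 0 v)) E f).
    have [P [sP Pv Pf]] := EF f Sf (leq_maxl _ _) fv.
    have [] := Hv (fun e => ~ P e /\ ~ False) => //.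
    by exists P, (fun=> False); split.
  have [|||Q [sQ Qv Qg]] := EF (dual g).
  + exact: Sigma11_dual.
  + by rewrite obound_dual leq_maxr.
  + by apply/sat_dual => gv; apply: nfv; move: gv; rewrite (aeE w) -fg -(aeE w).
  have [] := Hv (fun e => ~ False /\ ~ Q e) => //.
  by exists (fun=> False), Q; split.
Qed.

End Translation.

(** * Failure of choice, of comprehension, and of Basic Law V *)

Section Failures.
Variable k : closedFieldType.
Hypothesis k_char0 : [pchar k] =i pred0.
Implicit Types (s c v : seq k) (x y z : k).

Local Notation M := (definable_structure (@number k)).

Lemma tuple1_ex (v : 1.-tuple k) : exists x, v = [tuple x].
Proof. by case: v => -[|x []] // i; exists x; apply: val_inj. Qed.

Lemma tuple2_ex (v : 2.-tuple k) : exists x y, v = [tuple x; y].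
Proof. by case: v => -[|x [|y []]] // i; exists x, y; apply: val_inj. Qed.

Lemma number_uniformly_definable : uniformly_definable (@number k).
Proof.
move=> m th th0.
have sth : Def [::] (fun e : nat -> k => fholds e th).
  by apply: Def_fholds; apply: formula_over_sub th0.
have [f f0 fE] := Def_has_number k_char0 sth.
exists f; first by apply: formula_over_sub f0.
move=> a b X Xth; rewrite number_eq // -fholds_nth.
have -> : fholds (nth 0 (b :: a)) f = has_number (fun x =>
    fholds (scons x (nth 0 a)) th) b by rewrite -[LHS]/((fun e => fholds e f) _) -fE.
suff -> : extension X = (fun x => fholds (scons x (nth 0 a)) th) by [].
apply/funext => x; apply/propext; rewrite /extension Xth -fholds_nth.
by have -> : nth 0 (x :: a) = scons x (nth 0 a) by apply/funext => -[].
Qed.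

Lemma sqrt_ex x : exists y, y ^+ 2 = x.
Proof.
have s1 : size ('X^2 - x%:P) != 1%N by rewrite size_XnsubC.
have [y] := closed_rootP _ s1; rewrite rootE !hornerE subr_eq0 => /eqP.
by exists y.
Qed.

(** The values of a definable choice of square roots would contain exactly one
    of [z] and [- z], so they would be neither finite nor cofinite. *)
Lemma no_definable_sqrt s (P : (nat -> k) -> Prop) : Def s P ->
  ~ forall x, exists2 y, y ^+ 2 = x & forall z, P (pair_env x z) <-> z = y.
Proof.
move=> sP Px.
have /choice[phi Hphi] : forall x, exists y, y ^+ 2 = x /\ forall z,
  P (pair_env x z) <-> z = y.
  by move=> x; have [y yx Py] := Px x; exists y.
have [n /(_ (fun=> 0)) Hn] := fiber_bound (Def_ex sP).
have TE z : (exists x, P (pair_env x z)) <-> z = phi (z ^+ 2).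
  split=> [[x /(Hphi x).2 ->]|zE]; first by rewrite (Hphi x).1.
  by exists (z ^+ 2); apply/(Hphi (z ^+ 2)).2.
case: Hn => -[t _ tP].
  have [z] := fresh k_char0 (t ++ map -%R t); rewrite mem_cat negb_or => /andP[zt nzt].
  have := (Hphi (z ^+ 2)).1 => /eqP; rewrite eqf_sqr => /orP[] /eqP E.
    by move/negP: zt; apply; apply/tP/TE.
  move/negP: nzt; apply; apply/mapP; exists (- z); last by rewrite opprK.
  by apply/tP/TE; rewrite sqrrN.
have [z] := fresh k_char0 (0 :: t ++ map -%R t).
rewrite inE mem_cat !negb_or => /and3P[z0 zt nzt].
have inT y : y \notin t -> y = phi (y ^+ 2).
  by move=> /negP yt; apply/TE; apply: contrapT => /tP.
have nzt' : - z \notin t.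
  by apply: contra nzt => zt'; apply/mapP; exists (- z); rewrite ?opprK.
have : z = - z by rewrite (inT _ nzt') sqrrN -inT.
move=> /eqP; rewrite -addr_eq0 -mulr2n -mulr_natr mulf_eq0 (negbTE z0) /=.
by move=> /eqP/(natr_inj k_char0 (x2 := 0%N)).
Qed.

(** The squaring relation enters as a binary parameter, and [f] says that [P] is the singleton of a
    square root. The sections of a choice relation, itself definable, would select roots
    definably. *)
Lemma number_not_choice : ~ Sigma11_choice M.
Proof.
have sS : Def [::] (fun e : nat -> k => e 1%N ^+ 2 = e 0%N).
  exact: (@Def_eq _ _ (GRing.Exp (GRing.Var k 1) 2) (GRing.Var k 0)).
pose E : renv M := upd_rel (M := M) (fun n _ => define n.+1 (Def_prop [::] False)) 0
  (n := 1)
  (define 2 sS).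
pose f := FEx 1 (FAnd (FIn [tuple OVar 0; OVar 1] 0)
  (FAll 2 (FAnd (FImp (FIn [tuple OVar 2] 0) (FEq (OVar 2) (OVar 1)))
                (FImp (FEq (OVar 2) (OVar 1)) (FIn [tuple OVar 2] 0))))).
have fE x (P : definable k 1) :
    sat (M := M) (upd_seq (M := M) (fun=> 0) [tuple x]) (upd_rel (M := M) (n := 0) E 0 P)
      f <->
    exists y, y ^+ 2 = x /\ forall z, val P [tuple z] <-> z = y.
  rewrite /= /E upd_rel_same upd_rel_other // upd_rel_same /=.
  have tup2 (g : oterm -> k) t u : map_tuple g [tuple t; u] = [tuple g t; g u] by apply:
    val_inj.
  have tup1 (g : oterm -> k) t : map_tuple g [tuple t] = [tuple g t] by apply: val_inj.
  split=> -[y [yx Hy]]; exists y; split=> //.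
    by move=> z; have := Hy z; rewrite tup1.
  by move=> z; rewrite tup1; split=> /Hy.
move/(_ 0%N 0%N f (fun=> 0) E isT) => [v|R HR].
  have [x ->] := tuple1_ex v.
  have [y yx] := sqrt_ex x; exists (define 1 (Def_mem [:: y])); apply/fE.
  by exists y; split=> // z /=; rewrite inE; split=> /eqP.
have [s [Q [sQ RQ]]] := @definable_Def k 2 R; apply: (no_definable_sqrt sQ) => x.
pose g j : GRing.term k := if j is j'.+1 then if j' is 0 then GRing.Var k 0 else
  GRing.NatConst k 0
  else GRing.Const x.
have sg j : term_over [set` x :: s] (g j) by case: j => [|[]] //=; rewrite mem_head.
have sQ' : Def (x :: s) Q by apply: Def_mono sQ => y ys; rewrite inE ys orbT.
have QE z : Q (fun j => feval (nth 0 [:: z]) (g j)) = Q (pair_env x z).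
  by congr Q; apply/funext => -[|[]].
have [|y [yx Hy]] := (fE x (define 1 (Def_subs sg sQ'))).1.
  apply: HR => w; have [z ->] := tuple1_ex w.
  by rewrite RQ nth_scat -QE.
by exists y => // z; rewrite -Hy -QE.
Qed.

Lemma number_of_list s : uniq s -> number (define 1 (Def_mem s)) = (size s)%:R.
Proof. by move=> us; apply/number_eq => //; exists s => //; left. Qed.

Lemma number_not_Pi11 : ~ comprehension M Pi11.
Proof.
pose f := FAllR 0 0 (FNot (FEq (OAbs 0) (OVar 0))).
move/(_ 0%N f (fun=> 0) (fun n _ => define n.+1 (Def_prop [::] False)) isT) => [R HR].
have {}HR x : extension R x <-> forall X, number X <> x.
  by rewrite /extension HR /=; split=> H X; have := H X; rewrite upd_rel_same.
have no_long_list (h : nat -> k) s : injective h -> (forall n, h n \in s) -> False.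
  move=> h_inj hs; have := @uniq_leq_size _ (map h (iota 0 (size s).+1)) s.
  rewrite map_inj_uniq // iota_uniq size_map size_iota ltnn => H.
  by have // : false by apply: (H isT) => _ /mapP[n _ ->].
have [n [[s _ Hs]|[s _ Hs]]] := extension_small_or_cosmall R; last first.
  (* The numbers do not fit into a finite list: finite sets realize every natural number. *)
  apply: (@no_long_list (fun n => n%:R) s) => [|n']; first exact: natr_inj.
  apply: Hs; rewrite HR; apply/existsNP.
  pose l : seq k := [seq i%:R | i <- iota 0 n'].
  have ul : uniq l by rewrite map_inj_uniq ?iota_uniq //; apply: natr_inj.
  exists (define 1 (Def_mem l)); rewrite number_of_list // size_map size_iota.
  by apply.
have nat0 m : (m.+1%:R : k) != 0 by apply/eqP => /(natr_inj k_char0 (x2 := 0%N)).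
(* Neither do the non-numbers: the inverses of the integers from 2 on are not integers. *)
apply: (@no_long_list (fun n => n.+2%:R^-1) s) =>
  [i j /invr_inj/(natr_inj k_char0)[]//|i].
apply/Hs/HR => X /number_eq -/(_ k_char0)[l _ [] [_ E]].
  have : (1%:R : k) = (size l * i.+2)%:R by rewrite natrM -E mulVf.
  by move/(natr_inj k_char0)/esym/eqP; rewrite muln_eq1 andbF.
have : ((size l).+1 * i.+2 + 1)%:R = 0%:R :> k.
  by rewrite natrD natrM -[(size l).+1%:R]opprK -E mulNr mulVf // addNr.
by move/(natr_inj k_char0); rewrite addn1.
Qed.

Lemma not_Delta11_BL0 (del : definable k 1 -> k) :
  ~ Delta11_BL0 (definable_structure del).
Proof.
set N := definable_structure del => -[BLV D11].
pose sing x := define 1 (Def_mem [:: x]).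
have singE x (X : definable k 1) : (forall z, val X [tuple z] <-> z = x) <-> X = sing x.
  split=> [H|-> z]; last by rewrite /= inE; split=> /eqP.
  apply/srel_eq => v; have [z ->] := tuple1_ex v.
  by rewrite H /= inE; split=> /eqP.
have delE X Y : del X = del Y <-> X = Y := BLV X Y.
have sing_inj x y : sing x = sing y -> x = y.
  by move=> E; apply/esym/((singE x _).2 (esym E) y)/((singE y _).2 erefl y).
(* The singleton of a point is unique, so it may be quantified existentially or universally; hence
   the two forms [f] and [g] of the graph. *)
pose isS := FAll 2 (FAnd (FImp (FIn [tuple OVar 2] 0) (FEq (OVar 2) (OVar 0)))
                (FImp (FEq (OVar 2) (OVar 0)) (FIn [tuple OVar 2] 0))).
pose f := FExR 0 0 (FAnd isS (FEq (OAbs 0) (OVar 1))).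
pose g := FAllR 0 0 (FImp isS (FEq (OAbs 0) (OVar 1))).
pose E : renv N := fun n _ => define n.+1 (Def_prop [::] False).
have isSE x y X : sat (M := N) (upd_seq (M := N) (fun=> 0) [tuple x; y])
    (upd_rel (M := N) (n := 0) E 0 X) isS <-> X = sing x.
  have tup1 (h : oterm -> k) t : map_tuple h [tuple t] = [tuple h t] by apply: val_inj.
  rewrite -singE /= upd_rel_same; split=> H z; have := H z; rewrite tup1 => -[H1 H2];
    split=> //.
have fE x y : sat (M := N) (upd_seq (M := N) (fun=> 0) [tuple x; y]) E f <-> y = del
  (sing x).
  split=> [[X [/isSE]]|yE]; first by rewrite /= upd_rel_same => -> /esym.
  by exists (sing x); split; [apply/isSE|rewrite /= upd_rel_same].
have gE x y : sat (M := N) (upd_seq (M := N) (fun=> 0) [tuple x; y]) E g <-> y = del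
  (sing x).
  split=> [H|-> X /isSE ->]; last by rewrite /= upd_rel_same.
  by have := H (sing x) ((isSE _ _ _).2 erefl); rewrite /= upd_rel_same => /esym.
have [||v|R HR] := D11 1%N f g (fun=> 0) E => //.
  by have [x [y ->]] := tuple2_ex v; rewrite fE gE.
have {}HR x y : val R [tuple x; y] <-> y = del (sing x) by rewrite HR fE.
have [s [P [sP RP]]] := @definable_Def k 2 R.
have PE x y : P (pair_env x y) <-> y = del (sing x) by rewrite -HR RP nth_scat.
have [n /(_ (fun=> 0))/finite_or_cofinite[t ut]] := fiber_bound (Def_ex sP).
have YE y : (exists x, P (scons x (scons y (fun=> 0)))) <-> exists x, y = del (sing x).
  by split=> -[x /PE H]; exists x.
case=> Ht.
  have := @uniq_leq_size _ [seq del (sing n%:R) | n <- iota 0 (size t).+1] t.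
  rewrite map_inj_uniq => [|i j /delE/sing_inj/(natr_inj k_char0)//].
  rewrite iota_uniq size_map size_iota ltnn => H.
  have // : false by apply: (H isT) => _ /mapP[i _ ->]; apply/Ht/YE; exists i%:R.
(* The map is a definable bijection from the complement of the empty list onto that of [t], so the
   two lists have equal length. *)
have t0 : size t = 0%N.
  symmetry; apply: (@Def_bijection_size _ k_char0 _ P [::] t sP) => // [x y|x _|y].
  - by move=> /PE ->; split=> //; apply/Ht/YE; exists x.
  - by exists (del (sing x)); split=> [|y /PE ->//]; apply/PE.
  - move/Ht/YE => [x yx]; exists x; split=> [|x' /PE]; first exact/PE.
    by rewrite yx => /delE/sing_inj.
pose empty : definable k 1 := define 1 (Def_prop [::] False).
have : del empty \notin t by rewrite (size0nil t0).
move/Ht/YE => [x /delE Ex].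
by have := (singE x empty).2 Ex x => -[_ /(_ erefl)].
Qed.

End Failures.

Theorem theorem4p16 (k : closedFieldType)
    (k_char0 : [pchar k]%R =i pred0) (k_sat : saturated k) :
  (exists num : definable k 1 -> k,
     uniformly_definable num /\
     [/\ Delta11_HP0 (definable_structure num),
         ~ Sigma11_PH0 (definable_structure num)
       & ~ Pi11_HP0 (definable_structure num)]) /\
  ~ (exists del : definable k 1 -> k,
       Delta11_BL0 (definable_structure del)).
Proof.
split; last by case=> del; apply: not_Delta11_BL0.
exists (@number k); split; first exact: number_uniformly_definable.
split.
- by split; [apply: number_Hume|apply: number_Delta11].
- by case=> _; apply: number_not_choice.
- by case=> _; apply: number_not_Pi11.
Qed.
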